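(* Let $G$ be a graph of order $n$ having largest Seidel eigenvalue $3$ with multiplicity $m$ (i.e. the largest eigenvalue of $S(G)$ is $3$ and its multiplicity as an eigenvalue of $S(G)$ is $m$). Assume that $G$ is maximal. Then $G$ is switching equivalent to one of the following: (1) $L(K_5)$ or $L(K_{2,4})$, if $n-m=5$; (2) $L(K_6)+K_1$ or $L(K_{2,5})$, if $n-m=6$; (3) $L(K_8)$, if $n-m=7$; (4) $L(K_{2,n-m-1})$, if $n-m=3$, $n-m=4$, or $n-m\geq 8$. Furthermore, if $G$ is strongly maximal, then it is switching equivalent to $L(K_8)$.
   Context: All graphs are finite, simple, undirected, without loops. The Seidel matrix of a graph $G$ is $S(G)=\mathbf{J}-\mathbf{I}-2A(G)$, where $A(G)$ is the adjacency matrix, $\mathbf{J}$ the all-ones matrix and $\mathbf{I}$ the identity matrix; equivalently, a Seidel matrix is a symmetric matrix with zero diagonal and all off-diagonal entries $\pm1$. Seidel eigenvalues of $G$ are the eigenvalues of $S(G)$. For a Seidel matrix $S$ with largest eigenvalue $\lambda$, consider the following conditions on a Seidel matrix $S'$: (a) the largest eigenvalue of $S'$ equals $\lambda$; (b) $S'$ contains $S$ as a proper principal submatrix; (c) $\operatorname{rank}(\lambda\mathbf{I}-S')=\operatorname{rank}(\lambda\mathbf{I}-S)$. $S$ is maximal if no Seidel matrix $S'$ satisfies (a), (b) and (c); $S$ is strongly maximal if no Seidel matrix $S'$ satisfies (a) and (b). A graph $G$ is maximal (resp. strongly maximal) if $S(G)$ is. For a graph $G=(V,E)$ and $U\subseteq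 V$, the graph $G^U$ obtained by switching with respect to $U$ has vertex set $V$ and is obtained from $G$ by keeping adjacency between pairs inside $U$ and pairs inside $V\setminus U$, and reversing adjacency between each vertex of $U$ and each vertex of $V\setminus U$. Two graphs are switching equivalent if one is isomorphic to a graph obtained from the other by switching. $L(\cdot)$ denotes the line graph, $K_a$ the complete graph, $K_{a,b}$ the complete bipartite graph, and $G+H$ the disjoint union of graphs $G$ and $H$. *)

(* Defs.v *)
From HB Require Import structures.
From mathcomp Require Import all_boot all_order all_algebra.

Set Implicit Arguments.
Unset Strict Implicit.
Unset Printing Implicit Defensive.

Import Order.TTheory GRing.Theory Num.Theory.
Local Open Scope ring_scope.

Record sgraph := SGraph {
  vertex :> finType;
  adj : rel vertex;
  adj_sym : symmetric adj;
  adj_irrefl : irreflexive adj }.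

Arguments adj {s}.

Definition isomorphic (G H : sgraph) : Prop :=
  exists2 f : G -> H, bijective f & forall x y, adj (f x) (f y) = adj x y.

Section Switching.
Variables (G : sgraph) (U : {set G}).

Definition switch_adj (x y : G) : bool :=
  if (x \in U) == (y \in U) then adj x y else ~~ adj x y.

Lemma switch_adj_sym : symmetric switch_adj.
Proof. by move=> x y; rewrite /switch_adj eq_sym adj_sym. Qed.

Lemma switch_adj_irrefl : irreflexive switch_adj.
Proof. by move=> x; rewrite /switch_adj eqxx adj_irrefl. Qed.

Definition switching : sgraph := SGraph switch_adj_sym switch_adj_irrefl.
End Switching.

Definition switching_equivalent (G H : sgraph) : Prop :=
  (exists U : {set H}, isomorphic G (switching U)) \/
  (exists U : {set G}, isomorphic H (switching U)).

Section Complete.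
Variable n : nat.

Definition complete_adj (x y : 'I_n) : bool := x != y.

Lemma complete_adj_sym : symmetric complete_adj.
Proof. by move=> x y; rewrite /complete_adj eq_sym. Qed.

Lemma complete_adj_irrefl : irreflexive complete_adj.
Proof. by move=> x; rewrite /complete_adj eqxx. Qed.

Definition complete : sgraph := SGraph complete_adj_sym complete_adj_irrefl.
End Complete.

Section CompleteBipartite.
Variables a b : nat.

Definition complete_bipartite_adj (x y : 'I_a + 'I_b) : bool :=
  match x, y with
  | inl _, inr _ | inr _, inl _ => true
  | _, _ => false
  end.

Lemma complete_bipartite_adj_sym : symmetric complete_bipartite_adj.
Proof. by case=> ? []. Qed.

Lemma complete_bipartite_adj_irrefl : irreflexive complete_bipartite_adj.
Proof. by case. Qed.

Definition complete_bipartite : sgraph :=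
  SGraph complete_bipartite_adj_sym complete_bipartite_adj_irrefl.
End CompleteBipartite.

Section DisjointUnion.
Variables G H : sgraph.

Definition disjoint_union_adj (x y : G + H) : bool :=
  match x, y with
  | inl u, inl v => adj u v
  | inr u, inr v => adj u v
  | _, _ => false
  end.

Lemma disjoint_union_adj_sym : symmetric disjoint_union_adj.
Proof. by case=> ? [] ? //=; rewrite adj_sym. Qed.

Lemma disjoint_union_adj_irrefl : irreflexive disjoint_union_adj.
Proof. by case=> ? /=; rewrite adj_irrefl. Qed.

Definition disjoint_union : sgraph :=
  SGraph disjoint_union_adj_sym disjoint_union_adj_irrefl.
End DisjointUnion.

Section LineGraph.
Variable G : sgraph.

Definition edges : {set {set G}} :=
  [set e | [exists x, exists y, adj x y && (e == [set x; y])]].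

Definition line_graph_adj (e f : {e : {set G} | e \in edges}) : bool :=
  (e != f) && (val e :&: val f != set0).

Lemma line_graph_adj_sym : symmetric line_graph_adj.
Proof. by move=> e f; rewrite /line_graph_adj eq_sym setIC. Qed.

Lemma line_graph_adj_irrefl : irreflexive line_graph_adj.
Proof. by move=> e; rewrite /line_graph_adj eqxx. Qed.

Definition line_graph : sgraph :=
  SGraph line_graph_adj_sym line_graph_adj_irrefl.
End LineGraph.

Section Seidel.
Variable R : rcfType.

(* Vertices are numbered by [enum_val]; nothing below depends on the
   numbering. *)
Definition adjacency_mx (G : sgraph) : 'M[R]_#|G| :=
  \matrix_(i, j) (adj (enum_val i) (enum_val j))%:R.

Definition seidel_mx (G : sgraph) : 'M[R]_#|G| :=
  const_mx 1 - 1%:M - 2%:R *: adjacency_mx G.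

Definition is_seidel n (S : 'M[R]_n) : Prop :=
  [/\ S^T = S, forall i, S i i = 0
    & forall i j, i != j -> S i j = 1 \/ S i j = -1].

Definition largest_eigenvalue n (S : 'M[R]_n) (lambda : R) : Prop :=
  eigenvalue S lambda /\ forall mu, eigenvalue S mu -> mu <= lambda.

(* The geometric multiplicity, used only for symmetric matrices, where it is
   also the algebraic one. *)
Definition eigenvalue_multiplicity n (S : 'M[R]_n) (lambda : R) : nat :=
  \rank (eigenspace S lambda).

(* [f] lists in increasing order the rows (and columns) that are kept. *)
Definition proper_principal_submx n n' (S : 'M[R]_n) (S' : 'M[R]_n') : Prop :=
  (n < n')%N /\
  exists2 f : 'I_n -> 'I_n', {homo f : i j / (i < j)%N} & S = mxsub f f S'.

Definition maximal_seidel n (S : 'M[R]_n) : Prop :=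
  exists2 lambda : R, largest_eigenvalue S lambda &
    ~ exists n' (S' : 'M[R]_n'),
      [/\ is_seidel S', largest_eigenvalue S' lambda,
          proper_principal_submx S S'
        & \rank (lambda%:M - S') = \rank (lambda%:M - S)].

Definition strongly_maximal_seidel n (S : 'M[R]_n) : Prop :=
  exists2 lambda : R, largest_eigenvalue S lambda &
    ~ exists n' (S' : 'M[R]_n'),
      [/\ is_seidel S', largest_eigenvalue S' lambda
        & proper_principal_submx S S'].

Definition maximal_graph (G : sgraph) : Prop := maximal_seidel (seidel_mx G).

Definition strongly_maximal_graph (G : sgraph) : Prop :=
  strongly_maximal_seidel (seidel_mx G).
End Seidel.

(* Main.v *)
Require Import Defs.
From Stdlib Require Import Classical.
From HB Require Import structures.
From mathcomp Require Import all_boot all_order all_algebra.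
From mathcomp Require Import complex lra ring zify.
Import Order.TTheory GRing.Theory Num.Theory.
Local Open Scope ring_scope.
Set Implicit Arguments.
Unset Strict Implicit.
Unset Printing Implicit Defensive.

(** Let [M = 3 I - S(G)]. As [3] is the largest Seidel eigenvalue, [M] is positive
    semidefinite, that is, the Gram matrix of vectors of norm [3] (meaning
    [v.v = 3]) with mutual products [1] and [-1], spanning a space of dimension
    [n - m]. Switching changes signs, so only the lines spanned by these vectors
    matter. If a vector [z] of their span has norm [3] and product [1] or [-1] with
    all of them, bordering [S(G)] by [z] keeps the largest eigenvalue and the rank.
    Maximality of [G] excludes this, so a [z] of norm [3] whose products with the
    line vectors are among [1], [-1], [3] and [-3] lies on one of the lines
    ([graph_line_system]); strong maximality even excludes every [z] of norm at most
    [3] with products [1] and [-1] ([strongly_maximal_no_extension]).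

    One consequence generates everything else: if three line vectors have mutual
    products [-1], their sum is again a line vector ([line_closure]). Choose signs
    so that a largest possible number [q] of line vectors [b_1, ..., b_q] have
    mutual products [1], and look at how any further line vector [v], up to sign,
    divides this clique into negative and positive products. Such a [v] exists,
    because a clique is linearly independent while [M] is singular.
    - If all divisions are of type 1 versus [q - 1], say [v] is negative at [k],
      then with [E = v + b_k] the lines are exactly those of [b_i] and [E - b_i].
      This is the line graph of [K_{2,q}], and [q = 6] is not saturated.
    - If some [v] is negative exactly at [i] and [j], put [t = v + b_i + b_j]. The
      closure property produces all vectors [t - b_k - b_l], and maximality of the
      clique excludes any other line. After a shift by [t / 2] these are the edges
      of a complete graph on [q + 1] vertices. Saturation excludes [q = 5] and
      [q = 6], semidefiniteness excludes [q > 7]; what remains is [L(K_5)] and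
      [L(K_8)].
    - Otherwise some division has three or more vectors on both sides. It must be
      3 versus 3, and dropping one vector of the clique reduces the situation to
      the previous one for [q = 5]; the dropped vector is the additional isolated
      vertex of [L(K_6) + K_1].
    The result is [classify_lines]. In each case explicit bases give the rank, which
    is [n - m], and in all cases but [L(K_8)] a short vector with products [1] and
    [-1] shows that [G] is not strongly maximal. *)

(** * Semidefiniteness from the largest eigenvalue *)

Lemma eigenvalue_spectral_diag (C : numClosedFieldType) n (A : 'M[C]_n) k :
  A \is normalmx -> eigenvalue A (spectral_diag A 0 k).
Proof.
move=> /orthomx_spectralP; set P := spectralmx A; set d := spectral_diag A.
move=> defA; have Pu : P \in unitmx by exact: spectral_unit.
apply/eigenvalueP; exists (row k P).
  rewrite {1}defA !mulmxA -row_mul mulmxV // -mulmxA -row_mul mul1mx row_mul.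
  by rewrite row_diag_mx -scalemxAl -rowE.
apply/eqP => rk0; have := mulmxV Pu => /(congr1 (row k)).
rewrite row_mul rk0 mul0mx row1 => /rowP/(_ k)/eqP.
by rewrite !mxE !eqxx eq_sym oner_eq0.
Qed.

(** Over [R[i]] the matrix [S] is Hermitian, hence unitarily diagonalizable with
    real spectrum; every spectral coefficient is a root of the characteristic
    polynomial of [S], so it is an eigenvalue over [R] already. *)
Lemma psd_of_eigenvalue_le (R : rcfType) n (S : 'M[R]_n) (lam : R) :
  S^T = S -> (forall mu, eigenvalue S mu -> mu <= lam) ->
  forall u : 'rV_n, 0 <= (u *m (lam%:M - S) *m u^T) 0 0.
Proof.
move=> symS le_lam u.
pose f := real_complex R; pose A : 'M[R[i]]_n := map_mx f S.
have hermA : A \is hermsymmx.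
  apply: realsym_hermsym.
    apply/is_hermitianmxP; rewrite expr0 scale1r map_mx_id //.
    by rewrite /A map_trmx symS.
  apply/mxOverP => i j; rewrite mxE; apply/complex_realP; by eexists.
have normA := hermitian_normalmx hermA.
have eigA := fun k => eigenvalue_spectral_diag k normA.
move/mxOverP: (hermitian_spectral_diag_real hermA) => realA.
move/orthomx_spectralP: (normA).
move: (spectral_unitarymx A) eigA realA; set P := spectralmx A.
set d := spectral_diag A => unitP eigA realA defA.
have Pu : P \in unitmx by exact: spectral_unit.
have le_d k : d 0 k <= f lam.
  have /complex_realP[x dx] := realA 0 k.
  move: (eigA k); rewrite dx lecR eigenvalue_root_char -map_char_poly.
  rewrite fmorph_root -eigenvalue_root_char; exact: le_lam.
rewrite -lecR.
pose v : 'rV[R[i]]_n := map_mx f u.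
pose w := v *m invmx P.
have wH : (map_mx Num.conj w)^T = P *m v^T.
  rewrite /w map_mxM /= trmx_mul (invmx_unitary unitP).
  congr (_ *m _).
    apply/matrixP=> i j; rewrite !mxE; exact: conjCK.
  apply/matrixP=> i j; rewrite !mxE; apply/conj_Creal/complex_realP; by eexists.
have -> : (((u *m (lam%:M - S) *m u^T) 0 0)%:C)%C =
   (w *m ((f lam)%:M - diag_mx d) *m (map_mx Num.conj w)^T) 0 0.
  rewrite wH /w.
  have -> : v *m invmx P *m ((f lam)%:M - diag_mx d) *m (P *m v^T) =
     v *m ((f lam)%:M - A) *m v^T.
    rewrite [in RHS]defA !mulmxBr !mulmxBl !mulmxA; congr (_ - _).
    by rewrite !mul_mx_scalar -!scalemxAl mulmxKV.
  by rewrite /v /A map_trmx -(map_scalar_mx f) -map_mxB -!map_mxM [RHS]mxE.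
rewrite mxE; apply: sumr_ge0 => k _.
rewrite mxE (bigD1 k) //= big1 ?addr0; last first.
  by move=> i /negbTE ik; rewrite !mxE ik !mulr0n subrr mulr0.
rewrite !mxE eqxx !mulr1n mulrAC -normCK mulr_ge0 ?exprn_ge0 //.
by rewrite subr_ge0.
Qed.

(** * The bilinear form of a symmetric matrix *)

Section Gram.
Variables (R : realFieldType) (n : nat) (M : 'M[R]_n).
Implicit Types (u v w x y z : 'rV[R]_n) (a : R).

Definition dot u v : R := (u *m M *m v^T) 0 0.

Lemma dotDl u v w : dot (u + v) w = dot u w + dot v w.
Proof. by rewrite /dot !mulmxDl mxE. Qed.

Lemma dotDr u v w : dot w (u + v) = dot w u + dot w v.
Proof. by rewrite /dot linearD mulmxDr mxE. Qed.

Lemma dotZl a u v : dot (a *: u) v = a * dot u v.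
Proof. by rewrite /dot -!scalemxAl mxE. Qed.

Lemma dotZr a u v : dot u (a *: v) = a * dot u v.
Proof. by rewrite /dot linearZ -scalemxAr mxE. Qed.

Lemma dotNl u v : dot (- u) v = - dot u v.
Proof. by rewrite -scaleN1r dotZl mulN1r. Qed.

Lemma dotNr u v : dot u (- v) = - dot u v.
Proof. by rewrite -scaleN1r dotZr mulN1r. Qed.

Lemma dot_suml (I : finType) (P : pred I) (F : I -> 'rV[R]_n) u :
  dot (\sum_(i | P i) F i) u = \sum_(i | P i) dot (F i) u.
Proof. by rewrite /dot !mulmx_suml summxE. Qed.

Hypothesis symM : M^T = M.

Lemma dotC u v : dot u v = dot v u.
Proof.
rewrite /dot -[RHS]trace_mx11 -[LHS]trace_mx11 -mxtrace_tr.
by rewrite !trmx_mul trmxK symM mulmxA.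
Qed.

Lemma dot_sumr (I : finType) (P : pred I) (F : I -> 'rV[R]_n) u :
  dot u (\sum_(i | P i) F i) = \sum_(i | P i) dot u (F i).
Proof. by rewrite dotC dot_suml; apply: eq_bigr => i _; rewrite dotC. Qed.

Hypothesis psdM : forall u, 0 <= dot u u.

(** Equality modulo the radical of the form, which for a semidefinite form is
    equality of the Euclidean vectors having this Gram matrix. *)
Definition same u v := forall w, dot u w = dot v w.
Definition parallel u v := same u v \/ same u (- v).

(** Otherwise subtracting a large multiple of [u] from [v] would give a vector of
    negative norm. *)
Lemma null_dot u : dot u u = 0 -> forall v, dot u v = 0.
Proof.
move=> u0 v; apply/eqP/negP => /negP duv.
have := psdM (v - ((dot v v + 1) / (2%:R * dot u v)) *: u).
rewrite !(dotDl, dotDr, dotNl, dotNr, dotZl, dotZr) u0 (dotC v u).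
set a := _ / _; have : a * dot u v = (dot v v + 1) / 2%:R by rewrite /a; field.
by move=> ->; lra.
Qed.

Lemma null_same u v : dot (u - v) (u - v) = 0 -> same u v.
Proof.
by move=> /null_dot uv w; have := uv w; rewrite dotDl dotNl; lra.
Qed.
End Gram.

Ltac dotE := rewrite ?(dotDl, dotDr, dotNl, dotNr, dotZl, dotZr).

(** * Saturated systems of equiangular lines *)

Section LineSystem.
Variables (R : realFieldType) (n : nat) (M : 'M[R]_n).
Hypothesis symM : M^T = M.
Hypothesis psdM : forall u, 0 <= dot M u u.
Local Notation "u '*d' v" := (dot M u v) (at level 40).
Implicit Types (u v w x y z : 'rV[R]_n) (a b c : R).

(** The admissible products of line vectors, [3] and [- 3] being those of parallel
    ones. *)
Definition odd_upto3 a := [\/ a = 1, a = -1, a = 3%:R | a = - 3%:R].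

(** Each line is present with both of its vectors of norm [3]. The field [line_sat]
    expresses maximality among the systems spanning the same space. *)
Record line_system (X : 'rV[R]_n -> Prop) : Prop := LineSystem {
  line_norm : forall v, X v -> v *d v = 3%:R;
  line_opp : forall v, X v -> X (- v);
  line_dot : forall v w, X v -> X w -> odd_upto3 (v *d w);
  line_sat : forall z, z *d z = 3%:R -> (forall x, X x -> odd_upto3 (z *d x)) -> X z
}.

Variable X : 'rV[R]_n -> Prop.
Hypothesis HX : line_system X.

Lemma line_same v w : X v -> X w -> v *d w = 3%:R -> same M v w.
Proof.
move=> Xv Xw vw; apply: null_same => //.
dotE; rewrite (dotC symM w v) vw (line_norm HX Xv) (line_norm HX Xw); lra.
Qed.

Lemma line_parallel v w : X v -> X w -> v *d w = 3%:R \/ v *d w = - 3%:R ->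
  parallel M v w.
Proof.
move=> Xv Xw [vw|vw]; [left|right]; apply: line_same => //.
  exact: line_opp.
by rewrite dotNr vw opprK.
Qed.

Lemma odd_upto3_sum a b c : odd_upto3 a -> odd_upto3 b -> odd_upto3 c ->
  - 3%:R <= a + b + c <= 3%:R -> odd_upto3 (a + b + c).
Proof.
move=> oa ob oc /andP[lb ub].
by case: oa lb ub => ->; case: ob => ->; case: oc => -> lb ub;
  first [exfalso; lra | apply: Or41; lra | apply: Or42; lra
       | apply: Or43; lra | apply: Or44; lra].
Qed.

Lemma dot_bound z x : z *d z = 3%:R -> x *d x = 3%:R ->
  - 3%:R <= z *d x <= 3%:R.
Proof.
move=> zz xx; have := psdM (z + x); have := psdM (z - x).
dotE; rewrite (dotC symM x z) zz xx; lra.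
Qed.

(** The sum has norm [9 - 6 = 3]. Its product with a line vector is a sum of three
    odd numbers, and by the Cauchy-Schwarz inequality it lies between [- 3] and
    [3]; hence saturation applies. *)
Lemma line_closure v w x : X v -> X w -> X x ->
  v *d w = -1 -> w *d x = -1 -> v *d x = -1 -> X (v + w + x).
Proof.
move=> Xv Xw Xx vw wx vx.
have zz : (v + w + x) *d (v + w + x) = 3%:R.
  dotE; rewrite (dotC symM w v) (dotC symM x v) (dotC symM x w) vw wx vx.
  rewrite !(line_norm HX) //; lra.
apply: (line_sat HX) => // y Xy; have := dot_bound zz (line_norm HX Xy).
by dotE; apply: odd_upto3_sum; exact: (line_dot HX).
Qed.

(** * Cliques of vectors with product one *)

Definition clique q (b : 'I_q -> 'rV[R]_n) : Prop :=
  (forall i, X (b i)) /\ (forall i j, i != j -> b i *d b j = 1).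

Definition max_clique q (b : 'I_q -> 'rV[R]_n) : Prop :=
  clique b /\ forall c : 'I_q.+1 -> 'rV[R]_n, ~ clique c.

Lemma clique_dot q (b : 'I_q -> 'rV[R]_n) i j : clique b ->
  b i *d b j = 1 + 2%:R * (i == j)%:R.
Proof.
case=> Xb bb; have [->|ij] := eqVneq i j; last by rewrite bb // mulr0 addr0.
by rewrite (line_norm HX) // /=; lra.
Qed.

Lemma clique_extend q (b : 'I_q -> 'rV[R]_n) v : clique b -> X v ->
  (forall i, v *d b i = 1) -> exists c : 'I_q.+1 -> 'rV[R]_n, clique c.
Proof.
move=> [Xb bb] Xv vb.
exists (fun k => if unlift ord0 k is Some i then b i else v); split=> [k|k l].
  by case: unliftP.
case: unliftP => [i ->|->]; case: unliftP => [j ->|->] //.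
  by rewrite (inj_eq lift_inj) => /bb.
by move=> _; rewrite dotC.
Qed.

Lemma clique_replace q (b : 'I_q -> 'rV[R]_n) k v : clique b -> X v ->
  (forall i, i != k -> v *d b i = 1) ->
  clique (fun i => if i == k then v else b i).
Proof.
move=> [Xb bb] Xv vb; split=> [i|i j ij]; first by case: ifP.
case: ifPn => [/eqP ik|ik]; case: ifPn => [/eqP jk|jk].
- by rewrite ik jk eqxx in ij.
- exact: vb.
- by rewrite dotC // vb.
- exact: bb.
Qed.

Lemma max_clique_no_extend q (b : 'I_q -> 'rV[R]_n) v : max_clique b -> X v ->
  (forall i, v *d b i = 1) -> False.
Proof. by move=> [cb maxb] Xv vb; have [c /maxb] := clique_extend cb Xv vb. Qed.

Lemma sum_all_but_one q (f : 'I_q -> R) k :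
  (forall i, i != k -> f i = 1) -> \sum_i f i = f k + q%:R - 1.
Proof.
move=> f1; rewrite (bigD1 k) //= (eq_bigr (fun=> 1)) // sumr_const.
rewrite cardC1 card_ord -addrA; congr (_ + _).
by case: q k {f f1} => [[]//|q] _; rewrite -natr1 addrK.
Qed.

Lemma sum_clique q (b : 'I_q -> 'rV[R]_n) k : clique b ->
  (\sum_i b i) *d b k = q%:R + 2%:R.
Proof.
move=> cb; rewrite dot_suml (sum_all_but_one (k := k)) => [|i ik].
  by rewrite (clique_dot _ _ cb) eqxx /=; lra.
by rewrite (clique_dot _ _ cb) (negbTE ik) /=; lra.
Qed.

Lemma sum_const q (f : 'I_q -> R) a : (forall i, f i = a) ->
  \sum_i f i = a * q%:R.
Proof.
by move=> fa; rewrite (eq_bigr (fun=> a)) // sumr_const card_ord mulr_natr.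
Qed.

Definition negative_only_at q (b : 'I_q -> 'rV[R]_n) v k : Prop :=
  v *d b k = -1 /\ forall i, i != k -> v *d b i = 1.

(** Passing from [v] to [v + w - x] exchanges the products with [w] and [x], and
    keeps the product with every [b] such that [b.w = b.x]. All new lines below
    arise in this way. *)
Lemma swap_negative v w x : X v -> X w -> X x -> v *d w = -1 -> v *d x = 1 ->
  w *d x = 1 -> X (v + w - x).
Proof.
move=> Xv Xw Xx vw vx wx; apply: line_closure => //; first exact: line_opp.
  by rewrite dotNr wx.
by rewrite dotNr vx.
Qed.

Lemma third_index q (i j : 'I_q) : (2 < q)%N -> exists k, k != i /\ k != j.
Proof.
move=> q2; have : (0 < #|~: [set i; j]|)%N.
  have := cardsC [set i; j]; rewrite card_ord cards2 => /eqP; case: (i != j); lia.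
by case/card_gt0P => k; rewrite !inE negb_or => /andP[ki kj]; exists k.
Qed.

(** Replacing [b k] by [v] and then adding [w] would give a larger clique. *)
Lemma negative_only_at_uniq q (b : 'I_q -> 'rV[R]_n) v w k : max_clique b ->
  X v -> X w -> negative_only_at b v k -> negative_only_at b w k ->
  v *d w = 1 -> False.
Proof.
move=> [cb maxb] Xv Xw [vk vb] [wk wb] vw.
have cc := clique_replace cb Xv vb.
have [|c /maxb//] := clique_extend cc Xw.
by move=> i; case: (eqVneq i k) => [_|/wb//]; rewrite dotC.
Qed.

(** * Windmills: a line vector negative at a single place *)

Section Windmill.
Variables (q : nat) (b : 'I_q -> 'rV[R]_n).
Hypothesis mb : max_clique b.
Variables (v : 'rV[R]_n) (k : 'I_q).
Hypotheses (Xv : X v) (vk : negative_only_at b v k).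
Let E := v + b k.

Lemma windmill_center_norm : E *d E = 4%:R.
Proof.
rewrite /E; dotE; rewrite (dotC symM (b k) v) (clique_dot _ _ mb.1) eqxx vk.1.
by rewrite (line_norm HX) //=; lra.
Qed.

Lemma windmill_center_dot i : E *d b i = 2%:R.
Proof.
rewrite /E; dotE; rewrite (clique_dot _ _ mb.1).
have [<-|ki] := eqVneq k i; first by rewrite vk.1 /=; lra.
by rewrite vk.2 /= ?[i == k]eq_sym //; lra.
Qed.

Lemma windmill_line i : X (E - b i).
Proof.
rewrite /E; have [->|ik] := eqVneq i k; first by rewrite addrK.
have [Xb bb] := mb.1.
by apply: swap_negative => //; rewrite ?vk.1 ?vk.2 // bb // eq_sym.
Qed.

Lemma windmill_line_negative i : negative_only_at b (E - b i) i.
Proof.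
split=> [|j ji]; dotE; rewrite -dotDl -/E windmill_center_dot (clique_dot _ _ mb.1).
  by rewrite eqxx /=; lra.
by rewrite eq_sym (negbTE ji) /=; lra.
Qed.

(** If [u] and [E - b j] have product [-1], their sum with [b j] is a line vector
    whose product with every other [b i] is [3], so that [u] is parallel to
    [E - b i]. *)
Lemma windmill_cover u j : (1 < q)%N -> X u -> negative_only_at b u j ->
  exists i, parallel M u (E - b i).
Proof.
move=> q1 Xu uj; have [Xb bb] := mb.1.
have Xw := windmill_line j; have wj := windmill_line_negative j.
case: (line_dot HX Xu Xw) => uw.
- by case: (negative_only_at_uniq mb Xu Xw uj wj uw).
- have [i ij] : exists i, i != j.
    have : (0 < #|[set~ j]|)%N by rewrite cardsC1 card_ord; lia.
    by case/card_gt0P => i; rewrite !inE; exists i.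
  have Xa : X (u + (E - b j) + b j) by apply: line_closure => //; rewrite ?uj.1 ?wj.1.
  have ai : same M (u + (E - b j) + b j) (b i).
    apply: line_same => //; rewrite !dotDl -(dotDl M v) -dotDl -/E.
    by rewrite uj.2 // wj.2 // bb ?[j == i]eq_sym //; lra.
  exists i; right=> z; have := ai z; dotE; lra.
- by exists j; apply: line_parallel => //; left.
- by exists j; apply: line_parallel => //; right.
Qed.
End Windmill.

(** * Stars: a line vector negative at two places *)

(** The vectors [b i] behave like the edges joining a new vertex to the vertices
    [i], and the vectors [b i + b j - t] like the edges [ij]. *)
Definition star q (b : 'I_q -> 'rV[R]_n) t : Prop :=
  [/\ t *d t = 7%:R, forall i, t *d b i = 3%:R
    & forall i j, i != j -> X (t - b i - b j)].

(** The center [v + b i0 + b j0] is unchanged when [swap_negative] replaces [v]; two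
    swaps carry the pair of negative indices to any other pair. *)
Lemma star_of_two_negatives q (b : 'I_q -> 'rV[R]_n) v i0 j0 :
  clique b -> X v -> i0 != j0 -> v *d b i0 = -1 -> v *d b j0 = -1 ->
  (forall k, k != i0 -> k != j0 -> v *d b k = 1) -> star b (v + b i0 + b j0).
Proof.
move=> cb Xv ij vi vj vk; have [Xb bb] := cb.
set t := _ + b j0.
have tb k : t *d b k = 3%:R.
  rewrite /t; dotE; rewrite !(clique_dot _ _ cb).
  have [<-|ki] := eqVneq i0 k.
    by rewrite vi [j0 == i0]eq_sym (negbTE ij) /=; lra.
  have [<-|kj] := eqVneq j0 k; first by rewrite vj /=; lra.
  by rewrite vk /= ?[k == _]eq_sym //; lra.
have tt : t *d t = 7%:R.
  have tv : t *d v = 1.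
    rewrite /t; dotE; rewrite (line_norm HX Xv) !(dotC symM _ v) vi vj; lra.
  by rewrite {2}/t !dotDr tv !tb; lra.
split=> //.
pose Y i j := X (t - b i - b j).
have Ysym i j : Y i j -> Y j i by rewrite /Y addrAC.
have Ystep i j k : i != j -> k != i -> k != j -> Y i j -> Y k j.
  move=> nij ki kj; rewrite /Y => Yij.
  have -> : t - b k - b j = (t - b i - b j) + b i - b k.
    by apply/rowP => l; rewrite !mxE; ring.
  apply: swap_negative => //; dotE; rewrite -?dotDl -/t ?tb ?(clique_dot _ _ cb).
  - by rewrite [j == i]eq_sym (negbTE nij) eqxx /=; lra.
  - by rewrite ![_ == k]eq_sym (negbTE ki) (negbTE kj) /=; lra.
  - by rewrite [i == k]eq_sym (negbTE ki) /=; lra.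
have Y0 : Y i0 j0 by rewrite /Y /t addrAC addrK addrK.
move=> i j nij; rewrite -/(Y i j).
have Yi : exists2 l, l != i & Y i l.
  have [ii|ii] := eqVneq i i0; first by exists j0; rewrite ?ii // eq_sym.
  have [jj|jj] := eqVneq i j0; first by exists i0; rewrite ?jj //; exact: Ysym.
  by exists j0; [rewrite eq_sym | exact: (Ystep i0)].
have [l li Yil] := Yi; have [<-//|jl] := eqVneq l j.
by apply/Ysym/(Ystep l) => //; rewrite 1?eq_sym //; exact: Ysym.
Qed.

Lemma few_negatives q (f : 'I_q -> R) : (forall i, f i = 1 \/ f i = -1) ->
  (#|[set i | (f i == -1)%R]| <= 1)%N ->
  (forall i, f i = 1) \/ exists k, f k = -1 /\ forall i, i != k -> f i = 1.
Proof.
move=> f1; rewrite leq_eqVlt ltnS leqn0 cards_eq0 => /orP[/cards1P[k]|/eqP].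
  move=> /setP fk; right; exists k; split=> [|i ik].
    by have := fk k; rewrite !inE eqxx => /eqP.
  by have := fk i; rewrite !inE (negbTE ik); case: (f1 i) => // ->; rewrite eqxx.
move=> /setP f0; left=> i.
by have := f0 i; rewrite !inE; case: (f1 i) => // ->; rewrite eqxx.
Qed.

Lemma sign_cases q (f : 'I_q -> R) : (forall i, f i = 1 \/ f i = -1) ->
  [\/ (#|[set i | (f i == -1)%R]| <= 1)%N, (#|[set i | (- f i == -1)%R]| <= 1)%N
   | exists i j k l, [/\ i != j, k != l, f i = -1, f j = -1 & f k = 1 /\ f l = 1]].
Proof.
move=> f1; case: leqP => [?|/card_gt1P[i [j []]]]; first exact: Or31.
rewrite !inE => /eqP fi /eqP fj ij.
case: leqP => [?|/card_gt1P[k [l []]]]; first exact: Or32.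
rewrite !inE !eqr_opp => /eqP fk /eqP fl kl.
by apply: Or33; exists i, j, k, l.
Qed.

Lemma parallel_dot v w z : parallel M v w -> v *d z = w *d z \/ v *d z = - (w *d z).
Proof. by case=> e; [left|right]; rewrite e // dotNl. Qed.

Lemma parallel_oppl v w : parallel M (- v) w -> parallel M v w.
Proof.
by case=> e; [right|left] => z; have := e z; rewrite !dotNl; lra.
Qed.

Lemma odd_parallel v w z : parallel M v w -> odd_upto3 (z *d w) -> odd_upto3 (z *d v).
Proof.
rewrite ![z *d _]dotC // => /parallel_dot-/(_ z) [-> //|->].
by case=> ->; [apply: Or42|apply: Or41|apply: Or44|apply: Or43]; rewrite ?opprK.
Qed.

Lemma line_dot_or_parallel v w : X v -> X w ->
  parallel M v w \/ (v *d w = 1 \/ v *d w = -1).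
Proof.
move=> Xv Xw; case: (line_dot HX Xv Xw) => e; [right; by left|right; by right| |];
  left; apply: line_parallel => //; [by left|by right].
Qed.

Lemma exists_or_forall (I : finType) (P : I -> Prop) (Q : I -> Prop) :
  (forall i, P i \/ Q i) -> (exists i, P i) \/ (forall i, Q i).
Proof.
move=> PQ; suff H (s : seq I) : (exists i, P i) \/ {in s, forall i, Q i}.
  by case: (H (enum I)) => [?|Qs]; [left|right=> i; apply: Qs; rewrite mem_enum].
elim: s => [|i s [IHs|IHs]]; [by right|by left|].
have [Pi|Qi] := PQ i; first by left; exists i.
by right=> j; rewrite inE => /predU1P[->|/IHs].
Qed.

Section Star.
Variables (q : nat) (b : 'I_q -> 'rV[R]_n) (t : 'rV[R]_n).
Hypotheses (cb : clique b) (q4 : (3 < q)%N) (st : star b t).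

Lemma star_line_dot i j k : i != j ->
  (t - b i - b j) *d b k = 1 - 2%:R * ((i == k)%:R + (j == k)%:R).
Proof. by case: st => _ tb _ ij; dotE; rewrite tb !(clique_dot _ _ cb); lra. Qed.

Lemma star_cover_few_negatives u : X u ->
  (forall i, u *d b i = 1 \/ u *d b i = -1) ->
  (forall i j, i != j -> u *d t - u *d b i - u *d b j = 1 \/
                         u *d t - u *d b i - u *d b j = -1) ->
  (#|[set i | (u *d b i == -1)%R]| <= 1)%N ->
  ((forall i, u *d b i = 1) /\ (u *d t = 1 \/ u *d t = 3%:R)) \/
  exists k, negative_only_at b u k /\ u *d t = 1.
Proof.
move=> Xu ub ut /(few_negatives ub)[u1|[k [uk u1]]].
  left; split=> //; pose i0 := Ordinal (ltn_trans (isT : 0 < 3)%N q4).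
  have [i [ii _]] := third_index i0 i0 (ltnW q4).
  by have := ut i i0 ii; rewrite !u1; lra.
right; exists k; split=> //.
have [i [ik _]] := third_index k k (ltnW q4).
have [j [ji jk]] := third_index i k (ltnW q4).
by have := ut i j; have := ut i k ik; rewrite eq_sym uk !u1 // => + /(_ ji); lra.
Qed.

(** If [u] is on none of the lines of the star, then [u.t - u.b_i - u.b_j] is [1] or
    [-1] for all [i <> j]. A pair of negative indices makes [u.t + 2] one of these
    numbers and a pair of positive ones makes [u.t - 2] one of them, which is
    impossible simultaneously. *)
Lemma star_cover u : X u ->
  [\/ exists i, parallel M u (b i),
      exists i j, i != j /\ parallel M u (t - b i - b j)
    | exists2 w, w = u \/ w = - u &
       ((forall i, w *d b i = 1) /\ (w *d t = 1 \/ w *d t = 3%:R)) \/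
       exists k, negative_only_at b w k /\ w *d t = 1].
Proof.
move=> Xu; have [tt tb Xt] := st.
have [[i ui]|ub] := exists_or_forall (fun i => line_dot_or_parallel Xu (cb.1 i)).
  by apply: Or31; exists i.
have YP (p : 'I_q * 'I_q) :
    (p.1 != p.2 /\ parallel M u (t - b p.1 - b p.2)) \/
    (p.1 != p.2 -> u *d (t - b p.1 - b p.2) = 1 \/ u *d (t - b p.1 - b p.2) = -1).
  have [->|ij] := eqVneq p.1 p.2; first by right.
  by have [?|?] := line_dot_or_parallel Xu (Xt _ _ ij); [left|right].
have [[[i j] /= [ij pij]]|uY] := exists_or_forall YP.
  by apply: Or32; exists i, j.
have ut i j : i != j -> u *d t - u *d b i - u *d b j = 1 \/
                        u *d t - u *d b i - u *d b j = -1.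
  by move=> /(uY (i, j)) /=; dotE.
apply: Or33; have [few|few|[i [j [k [l [ij kl ui uj [uk ul]]]]]]] := sign_cases ub.
- exists u; [by left | exact: star_cover_few_negatives].
- exists (- u); first by right.
  apply: star_cover_few_negatives => [|i|i j ij|]; rewrite ?dotNl //; last first.
  + by under eq_finset => i do rewrite dotNl.
  + by have := ut i j ij; lra.
  + by have := ub i; lra.
  + exact: line_opp.

- by have := ut i j ij; have := ut k l kl; rewrite ui uj uk ul; lra.
Qed.

(** The line vector [t - b k - b j] is negative at [k] and [j] and has product [1]
    with [u]; exchanging [b j] for [u] cancels both negative products. *)
Lemma star_negative_only_extends u k : X u -> negative_only_at b u k ->
  u *d t = 1 -> exists2 v, X v & forall i, v *d b i = 1.
Proof.
move=> Xu [uk u1] ut; have [tt tb Xt] := st.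
have [j [jk _]] := third_index k k (ltnW q4).
have kj : k != j by rewrite eq_sym.
have Xkj := Xt _ _ kj.
have ukj : u *d (t - b k - b j) = 1 by dotE; rewrite ut uk u1 //; lra.
exists (t - b k - b j + b j - u).
  apply: swap_negative => //; first exact: cb.1.
  - by rewrite star_line_dot // (negbTE kj) eqxx /=; lra.
  - by rewrite dotC.
  - by rewrite dotC // u1.
move=> i; rewrite dotDl dotDl dotNl star_line_dot // (clique_dot _ _ cb).
have [->|ik] := eqVneq i k; first by rewrite uk (negbTE jk) /=; lra.
by rewrite u1 // /=; lra.
Qed.

Lemma star_sum_dot_center : (\sum_i b i) *d t = 3%:R * q%:R.
Proof.
by case: st => _ tb _; rewrite dot_suml; apply: sum_const => i; rewrite dotC.
Qed.

Lemma star_sum_norm : (\sum_i b i) *d (\sum_i b i) = (q%:R + 2%:R) * q%:R.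
Proof. by rewrite dot_sumr //; apply: sum_const => i; exact: sum_clique. Qed.

(** The vector [7 * sum b - 3 q * t] has norm [14 q (7 - q)]. *)
Lemma star_size_le7 : (q <= 7)%N.
Proof.
rewrite leqNgt; apply/negP => q7; have [tt tb _] := st.
have := psdM (7%:R *: \sum_i b i - (3%:R * q%:R) *: t).
dotE; rewrite (dotC symM t) star_sum_dot_center star_sum_norm tt.
have : (8%:R : R) <= q%:R by rewrite ler_nat.
by nra.
Qed.
End Star.

Section MaximalStar.
Variables (q : nat) (b : 'I_q -> 'rV[R]_n) (t : 'rV[R]_n).
Hypotheses (mb : max_clique b) (q4 : (3 < q)%N) (st : star b t).

Lemma max_star_cover u : X u ->
  (exists i, parallel M u (b i)) \/
  (exists i j, i != j /\ parallel M u (t - b i - b j)).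
Proof.
move=> Xu; case: (star_cover mb.1 q4 st Xu) => [|| [w wu wP]]; [by left|by right|].
have Xw : X w by case: wu => ->; [|exact: line_opp].
case: wP => [[w1 _]|[k [wk wt]]].
  by case: (max_clique_no_extend mb Xw).
have [v Xv v1] := star_negative_only_extends mb.1 q4 st Xw wk wt.
by case: (max_clique_no_extend mb Xv).
Qed.

(** Such a vector would be a line vector by saturation and enlarge the clique. *)
Lemma max_star_no_saturation z : z *d z = 3%:R -> (forall i, z *d b i = 1) ->
  (z *d t = 1 \/ z *d t = 3%:R) -> False.
Proof.
move=> zz zb zt; apply: (max_clique_no_extend mb _ zb).
apply: (line_sat HX) => // x /max_star_cover[[i xi]|[i [j [ij xij]]]].
  by apply: odd_parallel xi _; rewrite zb; exact: Or41.
apply: odd_parallel xij _; dotE; rewrite !zb.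
by case: zt => ->; [apply: Or42|apply: Or41]; lra.
Qed.

(** The vectors [sum b - 2 t] for [q = 5] and [3 t - sum b] for [q = 6] have norm [3]
    and product [1] with the whole clique. *)
Lemma max_star_size : q = 4%N \/ q = 7%N.
Proof.
have q7 := star_size_le7 mb.1 st; have [tt tb _] := st.
have tS : t *d (\sum_i b i) = 3%:R * q%:R.
  by rewrite dotC // (star_sum_dot_center st).
have SS := star_sum_norm mb.1; have St := star_sum_dot_center st.
have Sb k := sum_clique k mb.1.
have := q4; have := q7; have [->|q4'] := eqVneq q 4%N; first by left.
have [->|q7'] := eqVneq q 7%N; first by right.
have [q5|q5] := eqVneq q 5%N => _ _.
  exfalso; apply: (@max_star_no_saturation (\sum_i b i - 2%:R *: t)) => [|i|].
  - by dotE; rewrite SS St tS tt q5; lra.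
  - by dotE; rewrite Sb tb q5; lra.
  - by left; dotE; rewrite St tt q5; lra.
have q6 : q = 6%N by lia.
exfalso; apply: (@max_star_no_saturation (3%:R *: t - \sum_i b i)) => [|i|].
- by dotE; rewrite SS St tS tt q6; lra.
- by dotE; rewrite Sb tb q6; lra.
- by right; dotE; rewrite St tt q6; lra.
Qed.

(** Here [|sum b - 3 t|^2 = 63 - 126 + 63 = 0]. *)
Lemma star7_sum : q = 7%N -> same M (\sum_i b i) (3%:R *: t).
Proof.
move=> q7; apply: null_same => //; have [tt _ _] := st; dotE.
rewrite (dotC symM t) (star_sum_dot_center st) (star_sum_norm mb.1) tt q7; lra.
Qed.
End MaximalStar.

(** * Larger divisions of the clique *)

Lemma clique_sub q p (b : 'I_q -> 'rV[R]_n) (g : 'I_p -> 'I_q) :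
  clique b -> injective g -> clique (b \o g).
Proof. by case=> Xb bb gI; split=> [i|i j ij] /=; rewrite ?bb ?(inj_eq gI). Qed.

(** Keep two of the negative and four of the positive places. They carry a star of
    size six, and [3 t - sum b] has norm [3], product [1] with the six vectors and
    product [- 3] with a third negative [b l]. So it equals [- b l], although
    [b l] also has product [1] with the six vectors. *)
Lemma no_three_four_split q (b : 'I_q -> 'rV[R]_n) v : clique b -> X v ->
  (2 < #|[set i | (v *d b i == -1)%R]|)%N ->
  (3 < #|[set i | (v *d b i == 1)%R]|)%N -> False.
Proof.
move=> cb Xv /card_gt2P[i [j [l [[]]]]]; rewrite !inE.
move=> /eqP vi /eqP vj /eqP vl [ij jl li] /card_geqP[s [s_uniq s_size sP]].
have vs k : k \in s -> v *d b k = 1 by move/sP; rewrite inE => /eqP.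
have notin k : v *d b k = -1 -> k \notin s.
  by move=> vk; apply/negP => /vs; rewrite vk; lra.
have sz : size [:: i, j & s] == 6 by rewrite /= s_size.
pose g := tnth (Tuple sz).
have gI : injective g.
  by apply/tuple_uniqP; rewrite /= s_uniq !inE !negb_or ij !notin.
have c6 := clique_sub cb gI.
have g0 : g ord0 = i by rewrite /g (tnth_nth i).
have g1 : g (lift ord0 ord0) = j by rewrite /g (tnth_nth i).
have st : star (b \o g) (v + (b \o g) ord0 + (b \o g) (lift ord0 ord0)).
  apply: star_of_two_negatives => //=; rewrite ?g0 ?g1 // => k k0 k1.
  apply: vs; have := mem_tnth k (Tuple sz); rewrite -/(g k) !inE.
  by rewrite -{1}g0 -g1 !(inj_eq gI) (negbTE k0) (negbTE k1).
have lg k : b l *d (b \o g) k = 1.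
  rewrite cb.2 //; apply/eqP => lk.
  have := mem_tnth k (Tuple sz); rewrite -/(g k) -lk !inE (negbTE li).
  by rewrite [l == j]eq_sym (negbTE jl) (negbTE (notin _ vl)).
move: st; set t := v + _ + _ => st; have [tt tb _] := st.
have lt : b l *d t = 1.
  by rewrite /t !dotDr !lg dotC // vl; lra.
clearbody t.
have ls : b l *d (\sum_k (b \o g) k) = 6%:R.
  by rewrite dot_sumr // (@sum_const _ _ 1) //; lra.
have ll := line_norm HX (cb.1 l).
have ts : t *d (\sum_k (b \o g) k) = 18%:R.
  by rewrite dotC // (star_sum_dot_center st); lra.
have ss := star_sum_norm c6.
have : (3%:R *: t - \sum_k (b \o g) k + b l) *d (b \o g) ord0 = 0.
  apply: null_dot => //; dotE; rewrite !(dotC symM _ (b l)) lt ls ll.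
  by rewrite (dotC symM _ t) ts ss tt; lra.
by dotE; rewrite lg tb (sum_clique _ c6); lra.
Qed.

(** The line vectors [x + b i - u] and [u + b k - b j] are both negative only at
    [j] and have product [1], contrary to [negative_only_at_uniq]. *)
Lemma no_one_and_three_negatives q (b : 'I_q -> 'rV[R]_n) u x k i j :
  max_clique b -> X u -> X x -> negative_only_at b u k ->
  i != k -> j != k -> i != j -> x *d b k = -1 -> x *d b i = -1 -> x *d b j = -1 ->
  (forall m, m != k -> m != i -> m != j -> x *d b m = 1) -> x *d u = 1 -> False.
Proof.
move=> mb Xu Xx [uk u1] ik jk ij xk xi xj x1 xu; have [Xb bb] := mb.1.
have ui := u1 i ik; have uj := u1 j jk.
have [ki kj ji] : [/\ k != i, k != j & j != i] by split; rewrite eq_sym.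
have Xw : X (x + b i - u) by apply: swap_negative => //; rewrite dotC.
have Xz : X (u + b k - b j) by apply: swap_negative => //; exact: bb.
apply: (negative_only_at_uniq mb Xw Xz (k := j)).
- split=> [|m mj]; dotE; first by rewrite xj uj bb //; lra.
  rewrite (clique_dot _ _ mb.1).
  have [->|mk] := eqVneq m k; first by rewrite xk uk (negbTE ik) /=; lra.
  have [->|mi] := eqVneq m i; first by rewrite xi ui /=; lra.
  by rewrite x1 ?u1 //=; lra.
- split=> [|m mj]; dotE; rewrite !(clique_dot _ _ mb.1).
    by rewrite uj (negbTE kj) eqxx /=; lra.
  rewrite [j == m]eq_sym (negbTE mj).
  have [->|mk] := eqVneq m k; first by rewrite uk /=; lra.
  by rewrite u1 //=; lra.
- dotE; rewrite !(dotC symM _ u) xk xj ui uk uj (line_norm HX Xu) !bb //.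
  by rewrite (dotC symM u) xu; lra.
Qed.

(** The last three cases are the Gram descriptions of [L(K_{2,q})], of [L(K_{q+1})]
    for [q = 4] and [q = 7], and of [L(K_6) + K_1]. *)
Inductive line_classification : Prop :=
| ParallelToClique q (b : 'I_q -> 'rV[R]_n) of clique b
    & forall u, X u -> exists i, parallel M u (b i)
| Windmill q (b : 'I_q -> 'rV[R]_n) E of clique b & (1 < q)%N & q <> 6%N
    & E *d E = 4%:R & forall i, E *d b i = 2%:R & forall i, X (E - b i)
    & forall u, X u -> (exists i, parallel M u (b i)) \/
                       (exists i, parallel M u (E - b i))
| CompleteStar q (b : 'I_q -> 'rV[R]_n) t of clique b & star b t
    & q = 4%N \/ q = 7%N /\ same M (\sum_i b i) (3%:R *: t)
    & forall u, X u -> (exists i, parallel M u (b i)) \/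
                       (exists i j, i != j /\ parallel M u (t - b i - b j))
| CompleteStarPlusOne (b : 'I_5 -> 'rV[R]_n) t of clique b & star b t
    & X (\sum_i b i - 2%:R *: t)
    & forall u, X u -> [\/ exists i, parallel M u (b i),
                           exists i j, i != j /\ parallel M u (t - b i - b j)
                         | parallel M u (\sum_i b i - 2%:R *: t)].

Lemma positive_indices_compl q (b : 'I_q -> 'rV[R]_n) v :
  (forall i, v *d b i = 1 \/ v *d b i = -1) ->
  [set i | (v *d b i == 1)%R] = ~: [set i | (v *d b i == -1)%R].
Proof.
move=> vb; apply/setP=> i; rewrite !inE.
have ne : ((1 : R) == -1) = false by apply/eqP; lra.
by case: (vb i) => ->; rewrite eqxx ?ne // eq_sym ne.
Qed.

(** Without one of the negative vectors, say [b l], the clique carries a star of size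
    five whose vector [sum b' - 2 t] turns out to be [b l]. Every line outside this
    configuration would be negative at a single place of the six-clique, and this
    is refuted by a line of the star that is negative there as well. *)
Lemma classify_three_three q (b : 'I_q -> 'rV[R]_n) v :
  q = 6%N -> max_clique b -> X v -> (forall i, v *d b i = 1 \/ v *d b i = -1) ->
  #|[set i | (v *d b i == -1)%R]| = 3%N -> line_classification.
Proof.
move=> q6; move: b; rewrite q6 => b mb Xv vb N3; have cb := mb.1.
set N := [set i | _] in N3.
have [l lN] : exists l, l \in N by apply/card_gt0P; rewrite N3.
have : #|N :\ l| == 2 by have := cardsD1 l N; rewrite lN N3; lia.
case/cards2P => i [j [ij NE]].
have [il iN] : i != l /\ i \in N.
  by apply/andP; have := set21 i j; rewrite -NE !inE.
have [jl jN] : j != l /\ j \in N.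
  by apply/andP; have := set22 i j; rewrite -NE !inE.
have posP k : k != l -> k != i -> k != j -> v *d b k = 1.
  move=> kl ki kj; case: (vb k) => // vk.
  have : k \in N :\ l by rewrite !inE kl vk eqxx.
  by rewrite NE !inE (negbTE ki) (negbTE kj).
move: lN iN jN; rewrite !inE => /eqP vl /eqP vi /eqP vj.
have [li lj] : l != i /\ l != j by rewrite ![l == _]eq_sym.
have [i' ei _] := unlift_some li; have [j' ej _] := unlift_some lj.
have ij' : i' != j' by apply: contraNneq ij => e; rewrite ei ej e.
pose b' : 'I_5 -> 'rV[R]_n := b \o lift l.
have cb' : clique b' by apply: clique_sub cb lift_inj.
have st : star b' (v + b' i' + b' j').
  apply: star_of_two_negatives; rewrite // /b' /= -?ei -?ej //.
  by move=> k ki kj; apply: posP; rewrite ?ei ?ej ?(inj_eq lift_inj) // eq_sym neq_lift.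
have lb k : b l *d b' k = 1 by apply: cb.2; exact: neq_lift.
have ll := line_norm HX (cb.1 l).
have lt : b l *d (v + b' i' + b' j') = 1 by rewrite !dotDr !lb dotC // vl; lra.
move: st lt; move: (v + b' i' + b' j') => t st lt; have [tt tb Xt] := st.
have lS : b l *d (\sum_k b' k) = 5%:R.
  by rewrite dot_sumr // (@sum_const _ _ 1) //; lra.
have tS : t *d (\sum_k b' k) = 15%:R.
  by rewrite dotC // (star_sum_dot_center st); lra.
have SS := star_sum_norm cb'.
have zl : same M (\sum_k b' k - 2%:R *: t) (b l).
  apply: null_same => //; dotE; rewrite !(dotC symM _ (b l)) lt ll lS.
  by rewrite (dotC symM _ t) tS SS tt; lra.
have Xz : X (\sum_k b' k - 2%:R *: t).
  have zdot x : (\sum_k b' k - 2%:R *: t) *d x = b l *d x by exact: zl.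
  apply: (line_sat HX) => [|x Xx]; rewrite zdot; last exact: (line_dot HX (cb.1 l) Xx).
  by rewrite dotC // zdot.
have Yl p r : p != r -> (t - b' p - b' r) *d b l = -1.
  by move=> pr; rewrite dotC //; dotE; rewrite lt !lb; lra.
have Yb p r m : p != r ->
    (t - b' p - b' r) *d b (lift l m) = 1 - 2%:R * ((p == m)%:R + (r == m)%:R).
  by move=> pr; have := star_line_dot cb' st m pr.
have zdot x : b l *d x = (\sum_k b' k) *d x - 2%:R * (t *d x).
  by rewrite -zl; dotE.
have no_single u k : X u -> negative_only_at b u k -> False.
  move=> Xu uk; case: (unliftP l k) uk => [k' ->|->] uk.
    have [r [rk _]] := third_index k' k' (isT : 2 < 5)%N.
    have kr : k' != r by rewrite eq_sym.
    have ut : t *d u = 1.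
      have := zdot u; rewrite dotC // uk.2 ?neq_lift // dot_suml.
      rewrite (sum_all_but_one (k := k')) => [|m mk].
        by rewrite (dotC symM (b' k')) uk.1 /=; lra.
      by rewrite dotC // /b' /= uk.2 // (inj_eq lift_inj).
    apply: (no_one_and_three_negatives mb Xu (Xt _ _ kr) uk
              (i := l) (j := lift l r)) => //.
    - exact: neq_lift.
    - by rewrite (inj_eq lift_inj).
    - exact: neq_lift.
    - by rewrite Yb // eqxx (negbTE rk) /=; lra.
    - exact: Yl.
    - by rewrite Yb // eqxx (negbTE kr) /=; lra.
    - move=> m; case: (unliftP l m) => [m' ->|->]; last by rewrite eqxx.
      rewrite !(inj_eq lift_inj) => mk _ mr.
      by rewrite Yb // ![_ == m']eq_sym (negbTE mk) (negbTE mr) /=; lra.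
    - dotE; rewrite ut !(dotC symM _ u) uk.1 (uk.2 (lift l r)) ?(inj_eq lift_inj) //.
      by lra.
  have u1 m : u *d b' m = 1 by apply: uk.2; rewrite eq_sym neq_lift.
  have ut : t *d u = 3%:R.
    have := zdot u; rewrite dotC // uk.1 dot_suml (@sum_const _ _ 1) => [|m].
      by lra.
    by rewrite dotC.
  apply: (no_one_and_three_negatives mb Xu (Xt _ _ ij') uk
              (i := i) (j := j)) => //.
  - exact: Yl.
  - by rewrite ei Yb // eqxx [j' == i']eq_sym (negbTE ij') /=; lra.
  - by rewrite ej Yb // eqxx (negbTE ij') /=; lra.
  - move=> m; case: (unliftP l m) => [m' ->|->]; last by rewrite eqxx.
    rewrite ei ej !(inj_eq lift_inj) => _ mk mr.
    by rewrite Yb // ![_ == m']eq_sym (negbTE mk) (negbTE mr) /=; lra.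
  - by dotE; rewrite ut !(dotC symM _ u) !u1; lra.
apply: (CompleteStarPlusOne cb' st Xz) => u Xu.
have [ub|uY|[w wu wP]] := star_cover cb' isT st Xu; [exact: Or31|exact: Or32|].
have Xw : X w by case: wu => ->; [|exact: line_opp].
case: wP => [[w1 wt]|[k [wk wt]]]; last first.
  case: (no_single w (lift l k) Xw); split=> [|m]; first exact: wk.1.
  case: (unliftP l m) => [m' ->|-> _]; first by rewrite (inj_eq lift_inj); exact: wk.2.
  rewrite dotC // zdot dot_suml (sum_all_but_one (k := k)) => [|p pk].
    by rewrite !(dotC symM _ w) wk.1 wt; lra.
  by rewrite dotC // wk.2.
have zw : (\sum_k b' k) *d w = 5%:R.
  by rewrite dot_suml (@sum_const _ _ 1) => [|m]; [lra | rewrite dotC].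
have wl : w *d b l = 5%:R - 2%:R * (w *d t) by rewrite dotC // zdot zw (dotC symM t).
case: wt => wt.
  apply: Or33; have wz : parallel M w (\sum_k b' k - 2%:R *: t).
    apply: line_parallel => //; left; rewrite dotC // zl dotC // wl wt; lra.
  by case: wu wz => -> // /parallel_oppl.
case: (no_single w l Xw); split=> [|m]; first by rewrite wl wt; lra.
by case: (unliftP l m) => [m' -> _|->]; [exact: w1 | rewrite eqxx].
Qed.

Lemma classify_two_two q (b : 'I_q -> 'rV[R]_n) v : max_clique b -> X v ->
  (forall i, v *d b i = 1 \/ v *d b i = -1) ->
  (1 < #|[set i | (v *d b i == -1)%R]|)%N ->
  (#|[set i | (v *d b i == -1)%R]| <= #|[set i | (v *d b i == 1)%R]|)%N ->
  line_classification.
Proof.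
move=> mb Xv vb; have cb := mb.1; rewrite positive_indices_compl //.
set N := [set i | _]; have := cardsC N; rewrite card_ord => NC N1 NP.
have [N3|N2] := ltnP 2 #|N|.
  have [P4|P3] := ltnP 3 #|~: N|.
    by case: (no_three_four_split cb Xv N3); rewrite positive_indices_compl.
  have N3' : #|N| = 3%N by lia.
  have q6 : q = 6%N by lia.
  exact: classify_three_three q6 mb Xv vb N3'.
have /cards2P[i [j [ij NE]]] : #|N| == 2 by lia.
have q4 : (3 < q)%N by lia.
have st : star b (v + b i + b j).
  apply: star_of_two_negatives => // [||k ki kj].
  - by have := set21 i j; rewrite -NE inE => /eqP.
  - by have := set22 i j; rewrite -NE inE => /eqP.
  - case: (vb k) => // vk; have := in_set2 k i j; rewrite -NE inE vk eqxx.
    by rewrite (negbTE ki) (negbTE kj).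
move: (v + b i + b j) st => t st.
apply: (CompleteStar cb st); last exact: (max_star_cover mb q4 st).
have [q4'|q7] := max_star_size mb q4 st; [by left|right; split=> //].
exact: star7_sum st q7.
Qed.

(** For [q = 6] saturation adds the vectors [(sum b - E) / 2 - b i - b j]: the
    configuration is contained in that of [L(K_8)]. *)
Lemma windmill_size_neq6 q (b : 'I_q -> 'rV[R]_n) E : clique b ->
  E *d E = 4%:R -> (forall i, E *d b i = 2%:R) ->
  (forall u, X u -> (exists i, parallel M u (b i)) \/
                    (exists i, parallel M u (E - b i))) ->
  q = 6%N -> exists v, X v /\ ((forall i, v *d b i = 1 \/ v *d b i = -1) /\
    exists i j k l, [/\ i != j, k != l, v *d b i = -1, v *d b j = -1
      & v *d b k = 1 /\ v *d b l = 1]).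
Proof.
move=> cb EE Eb cover q6; rewrite q6 in b cb Eb cover *.
pose i : 'I_6 := ord0; pose j : 'I_6 := lift ord0 ord0.
have ij : i != j by [].
pose z := (1 / 2%:R) *: (\sum_k b k) - b i - b j - (1 / 2%:R) *: E.
have Sb k := sum_clique k cb.
have SE : (\sum_k b k) *d E = 12%:R.
  by rewrite dot_suml (@sum_const _ _ 2%:R) => [|k]; [lra | rewrite dotC].
have zb k : z *d b k = 1 - 2%:R * ((i == k)%:R + (j == k)%:R).
  by rewrite /z; dotE; rewrite Sb Eb !(clique_dot _ _ cb); lra.
have zE : z *d E = 0.
  by rewrite /z; dotE; rewrite SE EE !(dotC symM _ E) !Eb; lra.
have zz : z *d z = 3%:R.
  have zS : z *d (\sum_k b k) = 2%:R.
    rewrite dot_sumr // (bigD1 i) //= (bigD1 j) //= !zb !eqxx (negbTE ij).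
    rewrite (eq_bigr (fun=> 1)) => [|k /andP[ki kj]]; last first.
      by rewrite zb ![_ == k]eq_sym (negbTE ki) (negbTE kj) /=; lra.
    rewrite sumr_const (_ : #|_| = 4%N) /=; first lra.
    have -> : #|[pred k : 'I_6 | (k != i) && (k != j)]| = #|~: [set i; j]|.
      by apply: eq_card => k; rewrite !inE negb_or.
    by have := cardsC [set i; j]; rewrite cards2 ij card_ord; lia.
  rewrite {2}/z !dotDr !dotNr !dotZr zS zE !zb !eqxx (negbTE ij) [j == i]eq_sym.
  by rewrite (negbTE ij) /=; lra.
clearbody z.
have zb1 k : z *d b k = 1 \/ z *d b k = -1.
  rewrite zb; have [<-|_] := eqVneq i k; first by right; rewrite eq_sym (negbTE ij) /=; lra.
  by case: (j == k); [right|left] => /=; lra.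
exists z; split; last split=> //.
  apply: (line_sat HX zz) => x /cover[[k xk]|[k xk]]; apply: odd_parallel xk _.
    by case: (zb1 k) => ->; [exact: Or41 | exact: Or42].
  dotE; rewrite zE sub0r.
  by case: (zb1 k) => ->; [exact: Or42 | apply: Or41; rewrite opprK].
exists i, j, (Ordinal (isT : 2 < 6)%N), (Ordinal (isT : 3 < 6)%N).
by rewrite !zb /=; do !split=> //; lra.
Qed.

Lemma max_clique_exists N :
  (forall q (b : 'I_q -> 'rV[R]_n), clique b -> (q <= N)%N) ->
  exists q (b : 'I_q -> 'rV[R]_n), max_clique b.
Proof.
move=> bound; apply: NNPP => nomax.
suff H q : exists b : 'I_q -> 'rV[R]_n, clique b.
  by have [b /bound] := H N.+1; rewrite ltnn.
elim: q => [|q [b cb]].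
  by exists (fun=> 0); split; case.
apply: NNPP => noclique; apply: nomax; exists q, b; split=> // c cc.
by apply: noclique; exists c.
Qed.

Theorem classify_lines N :
  (forall q (b : 'I_q -> 'rV[R]_n), clique b -> (q <= N)%N) ->
  line_classification.
Proof.
move=> /max_clique_exists[q [b mb]]; have cb := mb.1.
have dot_neg v i : v *d b i = 1 \/ v *d b i = -1 ->
  (- v) *d b i = 1 \/ (- v) *d b i = -1 by rewrite dotNl; lra.
(* The configuration is a windmill unless some line vector has two negative and
   two positive products with the clique. *)
have [[v [Xv [vb [i [j [k [l [ij kl vi vj [vk vl]]]]]]]]]|nosplit] :=
  classic (exists v, X v /\ ((forall i, v *d b i = 1 \/ v *d b i = -1) /\
    exists i j k l, [/\ i != j, k != l, v *d b i = -1, v *d b j = -1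
      & v *d b k = 1 /\ v *d b l = 1])).
  have N1 : (1 < #|[set i | (v *d b i == -1)%R]|)%N.
    by apply/card_gt1P; exists i, j; rewrite !inE vi vj eqxx.
  have P1 : (1 < #|[set i | (v *d b i == 1)%R]|)%N.
    by apply/card_gt1P; exists k, l; rewrite !inE vk vl eqxx.
  have [NP|/ltnW PN] := leqP #|[set i | (v *d b i == -1)%R]| #|[set i | (v *d b i == 1)%R]|.
    exact: classify_two_two mb Xv vb N1 NP.
  have negE a : [set i | ((- v) *d b i == - a)%R] = [set i | (v *d b i == a)%R].
    by apply/setP => m; rewrite !inE dotNl eqr_opp.
  apply: (classify_two_two mb (line_opp HX Xv)) => [m||].
  - exact: dot_neg.
  - by rewrite negE.
  - by rewrite negE -{2}[1]opprK negE.
have single u : X u -> (exists i, parallel M u (b i)) \/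
    exists2 w, w = u \/ w = - u & exists k, negative_only_at b w k.
  move=> Xu; have [[i ui]|ub] :=
    exists_or_forall (fun i => line_dot_or_parallel Xu (cb.1 i)).
    by left; exists i.
  right; have [few|few|spl] := sign_cases ub.
  - have [u1|ok] := few_negatives ub few; first by case: (max_clique_no_extend mb Xu u1).
    by exists u; first by left.
  - have few' : (#|[set i | ((- u) *d b i == -1)%R]| <= 1)%N.
      by under eq_finset => i do rewrite dotNl.
    have [u1|ok] := few_negatives (fun i => dot_neg _ _ (ub i)) few'.
      by case: (max_clique_no_extend mb (line_opp HX Xu) u1).
    by exists (- u); first by right.
  - by case: nosplit; exists u.
have [[v Xv [k vk]]|none] := classic (exists2 v, X v & exists k, negative_only_at b v k); last first.
  apply: (ParallelToClique cb) => u Xu; have [//|[w wu wk]] := single u Xu.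
  by case: none; exists w => //; case: wu => ->; [|exact: line_opp].
have q1 : (1 < q)%N.
  rewrite ltnNge; apply/negP => q1.
  apply: (max_clique_no_extend mb (line_opp HX Xv)) => i.
  have -> : i = k by apply: ord_inj; have := ltn_ord i; have := ltn_ord k; lia.
  by rewrite dotNl vk.1 opprK.
have cover u : X u -> (exists i, parallel M u (b i)) \/
    (exists i, parallel M u (v + b k - b i)).
  move=> Xu; have [|[w wu [j wj]]] := single u Xu; [by left|right].
  have Xw : X w by case: wu => ->; [|exact: line_opp].
  have [i wi] := windmill_cover mb Xv vk q1 Xw wj; exists i.
  by case: wu wi => -> // /parallel_oppl.
have EE := windmill_center_norm mb Xv vk.
have Eb := windmill_center_dot mb vk.
apply: (Windmill cb q1 _ EE Eb (windmill_line mb Xv vk) cover) => q6.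
apply: nosplit; exact: windmill_size_neq6 cb EE Eb cover q6.
Qed.
End LineSystem.

(** * Adding one vertex to a Seidel matrix *)

Lemma dot_delta (R : realFieldType) n (M : 'M[R]_n) u i :
  dot M u (delta_mx 0 i) = (u *m M) 0 i.
Proof. by rewrite /dot trmx_delta -colE mxE. Qed.

(** Completing the square: bordering a Gram matrix by the products of [z] with
    the old vectors and by a norm [lam] adds [(lam - |z|^2) a^2] to the form. *)
Lemma dot_bordered (R : realFieldType) n (M : 'M[R]_n) (z x : 'rV_n) (lam a : R) :
  M^T = M ->
  dot (block_mx M (M *m z^T) (z *m M) lam%:M) (row_mx x a%:M) (row_mx x a%:M) =
  dot M (x + a *: z) (x + a *: z) + (lam - dot M z z) * a ^+ 2.
Proof.
move=> symM; rewrite !(dotDl, dotDr, dotZl, dotZr) (dotC symM z x) {1}/dot.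
rewrite mul_row_block tr_row_mx mul_row_col !mulmxDl !mul_scalar_mx tr_scalar_mx.
rewrite !mul_mx_scalar -!scalemxAl ?mulmxA.
have e : x *m M *m x^T = (dot M x x)%:M by rewrite [LHS]mx11_scalar.
have e1 : z *m M *m x^T = (dot M x z)%:M by rewrite dotC // [LHS]mx11_scalar.
have e2 : x *m M *m z^T = (dot M x z)%:M by rewrite [LHS]mx11_scalar.
by rewrite e e1 e2 !mxE eqxx !mulr1n; ring.
Qed.

Section Extension.
Variables (R : rcfType) (n : nat) (S : 'M[R]_n) (lam : R).
Let M := lam%:M - S.
Hypothesis symS : S^T = S.
Hypothesis psdM : forall u, 0 <= dot M u u.
Variable z : 'rV[R]_n.

(** [z *m M] lists the products of the new vector [z] with the old ones, and the
    Seidel matrix carries the opposite signs. *)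
Definition extend_mx : 'M[R]_(n + 1) := block_mx S (- (z *m M)^T) (- (z *m M)) 0.

Let symM : M^T = M.
Proof. by rewrite /M linearB /= tr_scalar_mx symS. Qed.

Let trzM : (z *m M)^T = M *m z^T.
Proof. by rewrite trmx_mul symM. Qed.

Lemma extend_mx_shift : lam%:M - extend_mx = block_mx M (M *m z^T) (z *m M) lam%:M.
Proof.
by rewrite /extend_mx scalar_mx_block opp_block_mx add_block_mx !opprK !add0r
  subr0 trzM.
Qed.

Lemma extend_mx_seidel : is_seidel S ->
  (forall i, (z *m M) 0 i = 1 \/ (z *m M) 0 i = -1) -> is_seidel extend_mx.
Proof.
move=> [_ S0 S1] zM.
have zN i : - (z *m M) 0 i = 1 \/ - (z *m M) 0 i = -1.
  by case: (zM i) => ->; [right|left; rewrite opprK].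
split.
- by rewrite /extend_mx tr_block_mx !linearN /= trmxK symS trmx0.
- move=> i; rewrite /extend_mx; case: (split_ordP i) => j ->.
    by rewrite block_mxEul S0.
  by rewrite block_mxEdr mxE.
move=> i j; rewrite /extend_mx.
case: (split_ordP i) => k ->; case: (split_ordP j) => l ->.
- by rewrite (inj_eq (@lshift_inj _ _)) block_mxEul; exact: S1.
- by rewrite block_mxEur => _; rewrite (ord1 l); have := zN k; rewrite !mxE.
- by rewrite block_mxEdl => _; rewrite (ord1 k); have := zN l; rewrite !mxE.
- by rewrite (ord1 k) (ord1 l) eqxx.
Qed.

Lemma extend_mx_psd : dot M z z <= lam -> forall u, 0 <= dot (lam%:M - extend_mx) u u.
Proof.
move=> zz u; rewrite -(hsubmxK u); set x := lsubmx u; set y := rsubmx u.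
have -> : y = (y 0 0)%:M by rewrite [LHS]mx11_scalar.
set a := y 0 0.
rewrite extend_mx_shift dot_bordered //.
by rewrite addr_ge0 // mulr_ge0 ?sqr_ge0 // subr_ge0.
Qed.

Lemma extend_mx_largest : dot M z z <= lam -> eigenvalue S lam ->
  largest_eigenvalue extend_mx lam.
Proof.
move=> zz /eigenvalueP[v vS v0]; split.
  apply/eigenvalueP; exists (row_mx v 0); last by rewrite row_mx_eq0 negb_and v0.
  rewrite /extend_mx mul_row_block !mul0mx !addr0 vS scale_row_mx scaler0.
  congr row_mx; rewrite mulmxN trzM mulmxA mulmxBr vS.
  by rewrite mul_mx_scalar subrr mul0mx oppr0.
move=> mu /eigenvalueP[w wS w0]; have := extend_mx_psd zz w.
rewrite /dot mulmxBr wS mul_mx_scalar -scalerBl -scalemxAl mxE.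
rewrite pmulr_lge0 ?subr_ge0 // mxE lt_neqAle eq_sym.
have sq k : w 0 k * w^T k 0 = w 0 k ^+ 2 by rewrite mxE expr2.
rewrite (eq_bigr _ (fun k _ => sq k)) sumr_ge0 ?andbT => [|k _]; last exact: sqr_ge0.
apply: contra w0; rewrite psumr_eq0 => [|k _]; last exact: sqr_ge0.
move=> /allP w0; apply/eqP/rowP => k; have := w0 k (mem_index_enum _).
by rewrite /= sqrf_eq0 mxE => /eqP.
Qed.

Lemma extend_mx_principal : proper_principal_submx S extend_mx.
Proof.
split; first by rewrite addn1.
exists (lshift 1) => //; apply/matrixP => i j.
by rewrite mxE block_mxEul.
Qed.

(** The bordered matrix is the Gram matrix of the old vectors together with a vector
    of their span. *)
Lemma extend_mx_rank : dot M z z = lam ->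
  \rank (lam%:M - extend_mx) = \rank M.
Proof.
move=> zz; apply/eqP; rewrite eqn_leq; apply/andP; split.
  have -> : lam%:M - extend_mx = col_mx 1%:M z *m M *m row_mx 1%:M z^T.
    rewrite extend_mx_shift mul_col_mx mul1mx mul_col_row !mulmx1.
    by congr block_mx; rewrite [RHS]mx11_scalar; congr scalar_mx.
  apply: leq_trans (mxrankM_maxl _ _) _; exact: mxrankM_maxr.
have -> : M = row_mx 1%:M 0 *m (lam%:M - extend_mx) *m col_mx 1%:M 0.
  rewrite extend_mx_shift mul_row_block !mul1mx !mul0mx !addr0.
  by rewrite mul_row_col mulmx1 mulmx0 addr0.
apply: leq_trans (mxrankM_maxl _ _) _; exact: mxrankM_maxr.
Qed.
End Extension.

(** * The line system of a maximal graph *)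

Definition gram (R : pzRingType) (H : sgraph) (x y : H) : R :=
  if x == y then 3%:R else if adj x y then 1 else -1.

Section GraphLines.
Variables (R : rcfType) (G : sgraph).
Local Notation S := (seidel_mx R G).
Local Notation M := (3%:R%:M - seidel_mx R G).
Local Notation e i := (delta_mx (0 : 'I_1) i : 'rV[R]_#|G|).

Lemma seidel_gramE i j : M i j = gram R (enum_val i) (enum_val j).
Proof.
rewrite /gram (inj_eq enum_val_inj) !mxE.
have [->|ij] := eqVneq i j; first by rewrite adj_irrefl /=; lra.
by case: (adj _ _) => /=; lra.
Qed.

Lemma seidel_sym : S^T = S.
Proof. by apply/matrixP => i j; rewrite !mxE adj_sym eq_sym. Qed.

Lemma seidel_gram_sym : M^T = M.
Proof. by rewrite linearB /= tr_scalar_mx seidel_sym. Qed.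

Lemma seidel_is_seidel : is_seidel S.
Proof.
split; first exact: seidel_sym.
  by move=> i; rewrite !mxE eqxx adj_irrefl /=; lra.
move=> i j ij; rewrite !mxE (negbTE ij).
by case: (adj _ _); [right|left] => /=; lra.
Qed.

Lemma dot_basis i j : dot M (e i) (e j) = gram R (enum_val i) (enum_val j).
Proof. by rewrite dot_delta -rowE mxE seidel_gramE. Qed.

Lemma gram_odd (x y : G) : odd_upto3 (gram R x y).
Proof.
by rewrite /gram; case: ifP => _; [exact: Or43|case: ifP => _; [exact: Or41|exact: Or42]].
Qed.

Definition graph_line (v : 'rV[R]_#|G|) : Prop := exists i, parallel M v (e i).

Lemma graph_line_basis i : graph_line (e i).
Proof. by exists i; left. Qed.

Hypothesis largest3 : largest_eigenvalue S 3%:R.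

Lemma seidel_gram_psd u : 0 <= dot M u u.
Proof. exact: (psd_of_eigenvalue_le seidel_sym largest3.2). Qed.

Lemma graph_line_extend z : dot M z z <= 3%:R ->
  (forall i, dot M z (e i) = 1 \/ dot M z (e i) = -1) ->
  let S' := extend_mx S 3%:R z in
  [/\ is_seidel S', largest_eigenvalue S' 3%:R & proper_principal_submx S S'].
Proof.
move=> zz ze; split.
- apply: extend_mx_seidel => //; [exact: seidel_sym | exact: seidel_is_seidel |].
  by move=> i; rewrite -dot_delta.
- apply: extend_mx_largest => //; first exact: seidel_sym.
    exact: seidel_gram_psd.
  exact: largest3.1.
- exact: extend_mx_principal.
Qed.

Lemma largest_eigenvalue_uniq n (A : 'M[R]_n) lam mu :
  largest_eigenvalue A lam -> largest_eigenvalue A mu -> lam = mu.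
Proof. by move=> [? lel] [? lem]; apply: le_anti; rewrite lem // lel. Qed.

Lemma strongly_maximal_no_extension z : strongly_maximal_graph R G ->
  dot M z z <= 3%:R -> ~ forall i, dot M z (e i) = 1 \/ dot M z (e i) = -1.
Proof.
move=> [lam /largest_eigenvalue_uniq/(_ largest3) -> noS] zz ze; apply: noS.
by have [? ? ?] := graph_line_extend zz ze; exists _, (extend_mx S 3%:R z).
Qed.

Lemma maximal_no_extension z : maximal_graph R G ->
  dot M z z = 3%:R -> ~ forall i, dot M z (e i) = 1 \/ dot M z (e i) = -1.
Proof.
move=> [lam /largest_eigenvalue_uniq/(_ largest3) -> noS] zz ze; apply: noS.
have zz' : dot M z z <= 3%:R by rewrite zz.
have [? ? ?] := graph_line_extend zz' ze; exists _, (extend_mx S 3%:R z).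
by split=> //; apply: extend_mx_rank => //; exact: seidel_sym.
Qed.

(** For saturation, a product [3] or [- 3] with a vertex vector makes [z] parallel to
    it, and if there is none then bordering by [z] contradicts maximality. *)
Lemma graph_line_system : maximal_graph R G -> line_system M graph_line.
Proof.
move=> maxG; have symM := seidel_gram_sym; have psdM := seidel_gram_psd.
have par v w : parallel M v w -> exists2 s, s = 1 \/ s = -1 &
   forall u, dot M v u = s * dot M w u.
  case=> vw; [exists 1; first by left|exists (-1); first by right].
    by move=> u; rewrite vw mul1r.
  by move=> u; rewrite vw dotNl mulN1r.
split.
- move=> v [i /par[s s1 vs]]; rewrite vs dotC // vs dot_basis /gram eqxx.
  by case: s1 => ->; lra.
- move=> v [i [vi|vi]]; exists i; [right|left] => u; rewrite dotNl vi //.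
    by rewrite dotNl.
  by rewrite dotNl opprK.
- move=> v w [i /par[s s1 vs]] [j /par[r r1 wr]].
  rewrite vs dotC // wr dotC // dot_basis; move: (gram_odd (enum_val i) (enum_val j)).
  by case: s1 => ->; case: r1 => -> [] ->;
    first [apply: Or41; lra|apply: Or42; lra|apply: Or43; lra|apply: Or44; lra].
- move=> z zz zX.
  have ee i : dot M (e i) (e i) = 3%:R by rewrite dot_basis /gram eqxx.
  have ze i : parallel M z (e i) \/ (dot M z (e i) = 1 \/ dot M z (e i) = -1).
    case: (zX _ (graph_line_basis i)) => zi.
    - by right; left.
    - by right; right.
    - by left; left; apply: null_same => //; dotE; rewrite (dotC symM _ z) zz zi ee; lra.
    - left; right; apply: null_same => //; rewrite opprK.
      by dotE; rewrite (dotC symM _ z) zz zi ee; lra.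
  have [//|/(maximal_no_extension maxG zz)//] := exists_or_forall ze.
Qed.

Lemma graph_clique_bound q (b : 'I_q -> 'rV[R]_#|G|) : maximal_graph R G ->
  clique M graph_line b -> (q <= #|G|)%N.
Proof.
move=> maxG [Xb bb].
have [f fP] : exists f : 'I_q -> 'I_#|G|, forall k, parallel M (b k) (e (f k)).
  exact: (@fin_all_exists 'I_q _ (fun k j => parallel M (b k) (e j)) Xb).
suff finj : injective f by have := leq_card f finj; rewrite !card_ord.
move=> k l fkl; apply/eqP; apply: contraT => kl; have := bb k l kl.
have symM := seidel_gram_sym.
have := parallel_dot (b l) (fP k); rewrite fkl !(dotC symM _ (b l)).
have := parallel_dot (b l) (fP l); rewrite !(dotC symM _ (b l)).
rewrite (line_norm (graph_line_system maxG)) //; lra.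
Qed.

(** Such a family consists of the vertex vectors of [G], permuted and with changed
    signs; the negative signs are the switching set. *)
Lemma switching_of_gram (H : sgraph) (v : H -> 'rV[R]_#|G|) :
  (forall h k, dot M (v h) (v k) = gram R h k) ->
  (forall h, graph_line (v h)) ->
  (forall i, exists h, parallel M (e i) (v h)) -> switching_equivalent G H.
Proof.
move=> vg vX ev; have symM := seidel_gram_sym.
have [f fP] : exists f : H -> 'I_#|G| * bool, forall h u,
    dot M (v h) u = (-1) ^+ (f h).2 * dot M (e (f h).1) u.
  apply: (@fin_all_exists H (fun=> 'I_#|G| * bool)%type (fun h p => forall u,
    dot M (v h) u = (-1) ^+ p.2 * dot M (e p.1) u)) => h.
  have [i [vi|vi]] := vX h.
    by exists (i, false) => u; rewrite vi mul1r.
  by exists (i, true) => u; rewrite vi dotNl mulN1r.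
pose F h : G := enum_val (f h).1; pose s h := (f h).2.
have gF h k : gram R h k = (-1) ^+ (s h) * (-1) ^+ (s k) * gram R (F h) (F k).
  by rewrite -vg fP (dotC symM) fP (dotC symM) dot_basis mulrA.
have gram1 (K : sgraph) (x y : K) : x != y -> gram R x y = 1 \/ gram R x y = -1.
  by move=> /negbTE xy; rewrite /gram xy; case: (adj _ _); [left|right].
have Finj : injective F.
  move=> h k Fhk; apply/eqP; apply: contraT => /gram1; rewrite gF Fhk /gram eqxx.
  by case: (s h); case: (s k); rewrite ?expr0 ?expr1; lra.
have [g gK] : exists g : G -> H, forall x, F (g x) = x.
  apply: (@fin_all_exists G (fun=> H : Type) (fun x h => F h = x)) => x; have [h xh] := ev (enum_rank x); exists h.
  apply/eqP; apply: contraT => /gram1.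
  have := parallel_dot (v h) xh; rewrite vg /gram eqxx dotC // fP dot_basis enum_rankK.
  rewrite -/(F h) -/(gram _ _ _) -/(s h).
  by case: (s h); rewrite ?expr0 ?expr1; lra.
right; exists [set x | s (g x)], F.
  by exists g => [h|x]; [apply: Finj; rewrite gK | exact: gK].
have gF' h : g (F h) = h by apply: Finj; rewrite gK.
move=> h k; rewrite /= /switch_adj !inE !gF'.
have [->|hk] := eqVneq h k; first by rewrite eqxx !adj_irrefl.
have := gF h k; rewrite /gram (inj_eq Finj) (negbTE hk).
by case: (adj h k); case: (adj (F h) (F k)); case: (s h); case: (s k) => //=;
  rewrite ?expr0 ?expr1; lra.
Qed.

End GraphLines.

(** * Line graphs as sums of two frame vectors *)

Section Frames.
Variables (R : rcfType) (n : nat) (M : 'M[R]_n).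
Hypothesis symM : M^T = M.
Local Notation "u '*d' v" := (dot M u v) (at level 40).

Lemma eq_set2 (T : finType) (x y z t : T) : x != y ->
  ([set x; y] == [set z; t]) = (x == z) && (y == t) || (x == t) && (y == z).
Proof.
move=> xy; apply/eqP/idP => [/setP e|].
  have := e x; have := e y; rewrite !inE !eqxx ?orbT /= => /esym yz /esym xz.
  case/orP: xz yz => /eqP xz; case/orP => /eqP yz; move: xy; rewrite xz yz eqxx //.
    by rewrite eqxx.
  by rewrite eqxx orbT.
by case/orP=> /andP[/eqP-> /eqP->] //; rewrite setUC.
Qed.

Lemma set2I_neq0 (T : finType) (x y z t : T) :
  ([set x; y] :&: [set z; t] != set0) = [|| x == z, x == t, y == z | y == t].
Proof.
apply/set0Pn/idP => [[u]|].
  by rewrite !inE => /andP[/orP[]/eqP-> /orP[]-> //]; rewrite !orbT.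
case/or4P => /eqP e; [exists x|exists x|exists y|exists y];
  by rewrite !inE e eqxx ?orbT.
Qed.

Definition edge_sum (K : sgraph) (c : K -> 'rV[R]_n) (e : line_graph K) :=
  \sum_(x in val e) c x.

Lemma edgeP (K : sgraph) (e : line_graph K) :
  exists x y, [/\ adj x y, x != y & val e = [set x; y]].
Proof.
case: e => e /=; rewrite inE => /existsP[x /existsP[y /andP[xy /eqP ->]]].
exists x, y; split=> //.
by apply/eqP => exy; move: xy; rewrite exy adj_irrefl.
Qed.

Lemma edge_sumE (K : sgraph) (c : K -> 'rV[R]_n) (e : line_graph K) x y :
  x != y -> val e = [set x; y] -> edge_sum c e = c x + c y.
Proof.
by move=> xy ee; rewrite /edge_sum ee big_setU1 ?big_set1 ?inE.
Qed.

Lemma edge_sum_onto (K : sgraph) (c : K -> 'rV[R]_n) x y : adj x y ->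
  exists e : line_graph K, edge_sum c e = c x + c y.
Proof.
move=> xy; have eE : [set x; y] \in edges K.
  by rewrite inE; apply/existsP; exists x; apply/existsP; exists y; rewrite xy eqxx.
exists (exist (fun e => e \in edges K) [set x; y] eE).
apply: edge_sumE => //; apply/eqP => exy; move: xy.
by rewrite exy adj_irrefl.
Qed.

(** The product of two edge sums is [2 |e :&: f| - 1], which is [3] for equal edges,
    [1] for adjacent ones and [- 1] for disjoint ones. *)
Lemma edge_sum_gram (K : sgraph) (c : K -> 'rV[R]_n) (rho : K -> R) :
  (forall x y, c x *d c y = 2%:R * (x == y)%:R - rho x * rho y) ->
  (forall x y, adj x y -> rho x + rho y = 1) ->
  forall e f : line_graph K, edge_sum c e *d edge_sum c f = gram R e f.
Proof.
move=> cc r1 e f; have [x [y [xy nxy ee]]] := edgeP e.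
have [z [t [zt nzt ef]]] := edgeP f.
rewrite (edge_sumE _ nxy ee) (edge_sumE _ nzt ef).
have rr : (rho x + rho y) * (rho z + rho t) = 1 by rewrite !r1 // mulr1.
have key : (c x + c y) *d (c z + c t) =
    2%:R * ((x == z)%:R + (x == t)%:R + (y == z)%:R + (y == t)%:R) - 1.
  by dotE; rewrite !cc -rr; ring.
rewrite key /gram /= /line_graph_adj -val_eqE ee ef eq_set2 // set2I_neq0.
have [xz|xz] := eqVneq x z; have [xt|xt] := eqVneq x t;
  have [yz|yz] := eqVneq y z; have [yt|yt] := eqVneq y t;
  rewrite /= ?mulr0n ?mulr1n; try lra;
  by move/eqP: nxy; move/eqP: nzt; congruence.
Qed.


(** The shift by [t / 2] turns [b i] into a sum of two frame vectors, the index
    [ord0] standing for the center, and makes all products of distinct frame vectors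
    equal to [- 1 / 4]. *)
Definition star_frame q (b : 'I_q -> 'rV[R]_n) t (k : 'I_q.+1) : 'rV[R]_n :=
  if unlift ord0 k is Some i then b i - (1 / 2%:R) *: t else (1 / 2%:R) *: t.

Lemma star_frame0 q (b : 'I_q -> 'rV[R]_n) t :
  star_frame b t ord0 = (1 / 2%:R) *: t.
Proof. by rewrite /star_frame unlift_none. Qed.

Lemma star_frame_lift q (b : 'I_q -> 'rV[R]_n) t i :
  star_frame b t (lift ord0 i) = b i - (1 / 2%:R) *: t.
Proof. by rewrite /star_frame liftK. Qed.

Lemma star_frame_dot q (b : 'I_q -> 'rV[R]_n) t k l :
  (forall i j, b i *d b j = 1 + 2%:R * (i == j)%:R) ->
  t *d t = 7%:R -> (forall i, t *d b i = 3%:R) ->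
  star_frame b t k *d star_frame b t l =
    2%:R * (k == l)%:R - 1 / 2%:R * (1 / 2%:R).
Proof.
move=> bb tt tb.
case: (unliftP ord0 k) => [i ->|->]; case: (unliftP ord0 l) => [j ->|->];
  rewrite ?star_frame0 ?star_frame_lift; dotE; rewrite ?(dotC symM (b _) t) ?tt ?tb ?bb.
- by rewrite (inj_eq lift_inj); lra.
- by rewrite eq_sym (negbTE (neq_lift _ _)) /=; lra.
- by rewrite (negbTE (neq_lift _ _)) /=; lra.
- by rewrite eqxx /=; lra.
Qed.

Lemma star_frame_edge q (b : 'I_q -> 'rV[R]_n) t i j :
  star_frame b t (lift ord0 i) + star_frame b t (lift ord0 j) = - (t - b i - b j).
Proof. by rewrite !star_frame_lift; apply/rowP => k; rewrite !mxE; lra. Qed.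

Lemma star_frame_edge0 q (b : 'I_q -> 'rV[R]_n) t i :
  star_frame b t ord0 + star_frame b t (lift ord0 i) = b i.
Proof. by rewrite star_frame0 star_frame_lift addrC subrK. Qed.

(** Both [b i] and [b i - E] are sums of a frame vector [E / 2] or [- E / 2] and of
    [b i - E / 2], and the latter are orthogonal. *)
Definition windmill_frame q (b : 'I_q -> 'rV[R]_n) E (k : 'I_2 + 'I_q) : 'rV[R]_n :=
  match k with
  | inl s => if s == ord0 then (1 / 2%:R) *: E else - ((1 / 2%:R) *: E)
  | inr i => b i - (1 / 2%:R) *: E
  end.

Definition left_side q (k : 'I_2 + 'I_q) : R := if k is inl _ then 1 else 0.

Lemma windmill_frame_dot q (b : 'I_q -> 'rV[R]_n) E k l :
  (forall i j, b i *d b j = 1 + 2%:R * (i == j)%:R) ->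
  E *d E = 4%:R -> (forall i, E *d b i = 2%:R) ->
  windmill_frame b E k *d windmill_frame b E l =
    2%:R * (k == l)%:R - left_side k * left_side l.
Proof.
move=> bb EE Eb; case: k => [s|i]; case: l => [r|j] /=.
- have -> : (inl s == inl r :> 'I_2 + 'I_q) = (s == r) by [].
  case: (unliftP ord0 s) => [s' ->|->]; case: (unliftP ord0 r) => [r' ->|->];
    rewrite ?eqxx ?[lift _ _ == ord0]eq_sym ?(negbTE (neq_lift _ _)) ?(ord1 s') ?(ord1 r')
      ?eqxx; dotE; rewrite EE /=; lra.
- by case: ifP => _; dotE; rewrite EE Eb /=; lra.
- by case: ifP => _; dotE; rewrite (dotC symM (b i) E) EE Eb /=; lra.
- have -> : (inr i == inr j :> 'I_2 + 'I_q) = (i == j) by [].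
  by dotE; rewrite EE (dotC symM (b i) E) !Eb bb; lra.
Qed.

Definition in_span (T : finType) (w : T -> 'rV[R]_n) u : Prop :=
  exists a : T -> R, same M u (\sum_k a k *: w k).

Lemma in_span_same (T : finType) (w : T -> 'rV[R]_n) u v :
  same M u v -> in_span w v -> in_span w u.
Proof. by move=> uv [a va]; exists a => z; rewrite uv. Qed.

Lemma in_span_gen (T : finType) (w : T -> 'rV[R]_n) k : in_span w (w k).
Proof.
exists (fun l => (l == k)%:R) => z; congr (_ *d _).
rewrite (bigD1 k) //= eqxx scale1r big1 ?addr0 // => l /negbTE ->.
by rewrite scale0r.
Qed.

Lemma in_spanZ (T : finType) (w : T -> 'rV[R]_n) a u :
  in_span w u -> in_span w (a *: u).
Proof.
move=> [f uf]; exists (fun k => a * f k) => z.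
rewrite dotZl uf -dotZl scaler_sumr; congr (_ *d _).
by apply: eq_bigr => k _; rewrite scalerA.
Qed.

Lemma in_spanN (T : finType) (w : T -> 'rV[R]_n) u : in_span w u -> in_span w (- u).
Proof. by rewrite -scaleN1r; exact: in_spanZ. Qed.

Lemma in_spanD (T : finType) (w : T -> 'rV[R]_n) u v :
  in_span w u -> in_span w v -> in_span w (u + v).
Proof.
move=> [f uf] [g vg]; exists (fun k => f k + g k) => z.
rewrite dotDl uf vg -dotDl -big_split; congr (_ *d _).
by apply: eq_bigr => k _; rewrite scalerDl.
Qed.

Lemma in_span_parallel (T : finType) (w : T -> 'rV[R]_n) u v :
  parallel M u v -> in_span w v -> in_span w u.
Proof.
by case=> [uv|uv] wv; apply: (in_span_same uv) => //; exact: in_spanN.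
Qed.

Lemma in_span_sum (T I : finType) (w : T -> 'rV[R]_n) (v : I -> 'rV[R]_n) :
  (forall i, in_span w (v i)) -> in_span w (\sum_i v i).
Proof.
move=> wv; elim/big_rec: _ => [|i x _ wx]; last exact: in_spanD.
exists (fun=> 0) => z; congr (_ *d _).
by rewrite big1 // => k _; rewrite scale0r.
Qed.

(** With [W] the matrix of the frame, [W M W^T] is nonsingular by the first hypothesis,
    and by the second one [M] factors through [W]. *)
Lemma rank_of_frame (T : finType) (w : T -> 'rV[R]_n) :
  (forall y : T -> R, (forall k, \sum_l y l * (w l *d w k) = 0) ->
     forall k, y k = 0) ->
  (forall i, in_span w (delta_mx 0 i)) ->
  \rank M = #|T|.
Proof.
move=> wfree wspan.
have [a aP] := @fin_all_exists 'I_n _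
  (fun i (a : T -> R) => same M (delta_mx 0 i) (\sum_k a k *: w k)) wspan.
pose W : 'M_(#|T|, n) := \matrix_k w (enum_val k).
have rowW k : row k W = w (enum_val k) by rewrite rowK.
have DE k l : (W *m M *m W^T) k l = dot M (w (enum_val k)) (w (enum_val l)).
  rewrite /dot -!rowW tr_row -row_mul [RHS]mxE mxE.
  by apply: eq_bigr => j _; rewrite [row k _ _ _]mxE [col l _ _ _]mxE.
apply/eqP; rewrite eqn_leq; apply/andP; split.
  pose A : 'M_(n, #|T|) := \matrix_(i, k) a i (enum_val k).
  have -> : M = A *m W *m M.
    apply/row_matrixP => i; rewrite !row_mul [LHS]rowE.
    have -> : row i A *m W = \sum_k a i k *: w k.
      rewrite mulmx_sum_row (reindex _ (onW_bij _ (enum_val_bij T))) /=.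
      by apply: eq_bigr => k _; rewrite rowW !mxE.
    by apply/rowP => j; rewrite -!dot_delta aP.
  by rewrite -mulmxA; apply: leq_trans (mxrankM_maxl _ _) (rank_leq_col _).
suff : row_free (W *m M *m W^T).
  rewrite /row_free => /eqP <-.
  apply: leq_trans (mxrankM_maxl _ _) _; exact: mxrankM_maxr.
apply: inj_row_free => v /rowP vD; apply/rowP => k; rewrite mxE.
pose y t := v 0 (enum_rank t).
have -> : v 0 k = y (enum_val k) by rewrite /y enum_valK.
apply: wfree => t; have := vD (enum_rank t); rewrite mxE [RHS]mxE => vt; rewrite -[RHS]vt.
rewrite (reindex _ (onW_bij _ (enum_val_bij T))) /=.
by apply: eq_bigr => l _; rewrite DE enum_rankK /y enum_valK.
Qed.
(** The Gram matrix [2 I - J / 4] sends [y] to zero only if [y] is constant, and its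
    row sum [2 - d / 4] vanishes for order [d = 8] alone. *)
Lemma complete_frame_free (T : finType) (w : T -> 'rV[R]_n) : #|T| <> 8%N ->
  (forall k l, w k *d w l = 2%:R * (k == l)%:R - 1 / 2%:R * (1 / 2%:R)) ->
  forall y : T -> R, (forall k, \sum_l y l * (w l *d w k) = 0) ->
  forall k, y k = 0.
Proof.
move=> T8 ww y y0; pose s := \sum_l y l.
have ys k : y k = s / 8%:R.
  have := y0 k; rewrite (eq_bigr (fun l => 2%:R * (y l * (l == k)%:R) - y l / 4%:R)).
    rewrite sumrB -mulr_sumr -mulr_suml (bigD1 k) //= eqxx big1; first by rewrite -/s /=; lra.
    by move=> l /negbTE ->; rewrite mulr0.
  by move=> l _; rewrite ww; field.
have s0 : s * (8%:R - #|T|%:R) = 0.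
  have : s = #|T|%:R * (s / 8%:R).
    by rewrite {1}/s (eq_bigr _ (fun k _ => ys k)) sumr_const mulr_natl.
  by lra.
have /eqP := s0; rewrite mulf_eq0 => /orP[/eqP s00|]; first by move=> k; rewrite ys s00 mul0r.
by rewrite subr_eq0 eqr_nat => /eqP e; case: T8.
Qed.

(** The Gram matrix [2 I + J] is positive definite. *)
Lemma clique_free q (b : 'I_q -> 'rV[R]_n) :
  (forall i j, b i *d b j = 1 + 2%:R * (i == j)%:R) ->
  forall y : 'I_q -> R, (forall k, \sum_l y l * (b l *d b k) = 0) ->
  forall k, y k = 0.
Proof.
move=> bb y y0; pose s := \sum_l y l.
have ys k : y k = - (s / 2%:R).
  have := y0 k; rewrite (eq_bigr (fun l => y l + 2%:R * (y l * (l == k)%:R))).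
    rewrite big_split -mulr_sumr -/s /=.
    have -> : \sum_l y l * (l == k)%:R = y k.
      rewrite (bigD1 k) //= eqxx mulr1 big1 ?addr0 // => l /negbTE ->.
      by rewrite mulr0.
    by lra.
  by move=> l _; rewrite bb; ring.
have s0 : s * (2%:R + q%:R) = 0.
  have : s = q%:R * - (s / 2%:R).
    by rewrite {1}/s (eq_bigr _ (fun k _ => ys k)) sumr_const card_ord mulr_natl.
  by lra.
have /eqP := s0; rewrite mulf_eq0 => /orP[/eqP s00|].
  by move=> k; rewrite ys s00 mul0r oppr0.
by rewrite -natrD pnatr_eq0.
Qed.

Lemma orthogonal_frame_free (T : finType) (w : T -> 'rV[R]_n) :
  (forall k, w k *d w k != 0) -> (forall k l, k != l -> w k *d w l = 0) ->
  forall y : T -> R, (forall k, \sum_l y l * (w l *d w k) = 0) ->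
  forall k, y k = 0.
Proof.
move=> wn ww y y0 k; have := y0 k; rewrite (bigD1 k) //= big1 => [|l lk].
  by rewrite addr0 => /eqP; rewrite mulf_eq0 (negbTE (wn k)) orbF => /eqP.
by rewrite ww // mulr0.
Qed.
End Frames.

(** * Switching classes and ranks of the configurations *)

Section Switching.
Variables (R : rcfType) (G : sgraph).
Local Notation S := (seidel_mx R G).
Local Notation M := (3%:R%:M - seidel_mx R G).
Local Notation e i := (delta_mx (0 : 'I_1) i : 'rV[R]_#|G|).
Local Notation X := (@graph_line R G).
Local Notation "u '*d' v" := (dot M u v) (at level 40).
Hypothesis largest3 : largest_eigenvalue S 3%:R.
Hypothesis maxG : maximal_graph R G.
Let symM := @seidel_gram_sym R G.
Let LS := graph_line_system largest3 maxG.

Lemma line_graph_switching (K : sgraph) (c : K -> 'rV[R]_#|G|) (rho : K -> R) :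
  (forall x y, c x *d c y = 2%:R * (x == y)%:R - rho x * rho y) ->
  (forall x y, adj x y -> rho x + rho y = 1) ->
  (forall x y, adj x y -> X (c x + c y)) ->
  (forall i, exists x y, adj x y /\ parallel M (e i) (c x + c y)) ->
  switching_equivalent G (line_graph K).
Proof.
move=> cc r1 Xc ec; apply: (switching_of_gram (v := edge_sum c)).
- exact: edge_sum_gram cc r1.
- by move=> f; have [x [y [xy nxy /(edge_sumE c nxy) ->]]] := edgeP f; exact: Xc.
- move=> i; have [x [y [xy exy]]] := ec i.
  by have [f fE] := edge_sum_onto c xy; exists f; rewrite fE.
Qed.

Lemma star_frame_line q (b : 'I_q -> 'rV[R]_#|G|) t k l :
  clique M X b -> star M X b t -> k != l -> X (star_frame b t k + star_frame b t l).
Proof.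
move=> [Xb _] [_ _ Xt].
case: (unliftP ord0 k) => [i ->|->]; case: (unliftP ord0 l) => [j ->|->] kl.
- rewrite star_frame_edge; apply: (line_opp LS); apply: Xt.
  by rewrite (inj_eq lift_inj) in kl.
- by rewrite addrC star_frame_edge0.
- by rewrite star_frame_edge0.
- by rewrite eqxx in kl.
Qed.

Lemma parallel_opp n (A : 'M[R]_n) u v : parallel A u v -> parallel A u (- v).
Proof. by case=> uv; [right; rewrite opprK|left]. Qed.

Lemma star_frame_cover q (b : 'I_q -> 'rV[R]_#|G|) t u :
  (exists i, parallel M u (b i)) \/
  (exists i j, i != j /\ parallel M u (t - b i - b j)) ->
  exists x y : complete q.+1, adj x y /\ parallel M u (star_frame b t x + star_frame b t y).
Proof.
case=> [[i ui]|[i [j [ij uij]]]].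
  exists ord0, (lift ord0 i); rewrite star_frame_edge0; split=> //.
exists (lift ord0 i), (lift ord0 j); rewrite star_frame_edge.
rewrite /= /complete_adj (inj_eq lift_inj); split=> //.
exact: parallel_opp.
Qed.

Lemma complete_star_switching q (b : 'I_q -> 'rV[R]_#|G|) t :
  clique M X b -> star M X b t ->
  (forall u, X u -> (exists i, parallel M u (b i)) \/
                    (exists i j, i != j /\ parallel M u (t - b i - b j))) ->
  switching_equivalent G (line_graph (complete q.+1)).
Proof.
move=> cb st cover; have [tt tb _] := st.
apply: (@line_graph_switching (complete q.+1) (star_frame b t) (fun=> 1 / 2%:R)).
- by move=> k l; apply: star_frame_dot => // i j; exact: (clique_dot LS).
- by move=> _ _ _; lra.
- by move=> x y xy; exact: star_frame_line.
- by move=> i; apply/star_frame_cover/cover; exact: graph_line_basis.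
Qed.

(** The vector [sum b - 2 t] has product [1 / 2] with every frame vector, so its
    opposite has product [- 1] with every edge and represents the isolated vertex. *)
Lemma complete_star_plus_switching (b : 'I_5 -> 'rV[R]_#|G|) t :
  clique M X b -> star M X b t -> X (\sum_i b i - 2%:R *: t) ->
  (forall u, X u -> [\/ exists i, parallel M u (b i),
                        exists i j, i != j /\ parallel M u (t - b i - b j)
                      | parallel M u (\sum_i b i - 2%:R *: t)]) ->
  switching_equivalent G (disjoint_union (line_graph (complete 6)) (complete 1)).
Proof.
move=> cb st Xz cover; have [tt tb _] := st; set z := _ - _ in Xz cover.
pose K := complete 6; pose c : K -> 'rV[R]_#|G| := star_frame b t.
have cc (k l : K) : c k *d c l = 2%:R * (k == l)%:R - 1 / 2%:R * (1 / 2%:R).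
  by apply: star_frame_dot => // i j; exact: (clique_dot LS).
have zb i : z *d b i = 1.
  by rewrite /z; dotE; rewrite (sum_clique LS i cb) tb; lra.
have zt : z *d t = 1.
  by rewrite /z; dotE; rewrite (star_sum_dot_center symM st) tt; lra.
clearbody z.
have zc (k : K) : z *d c k = 1 / 2%:R.
  rewrite /c; case: (unliftP ord0 k) => [i ->|->];
    rewrite ?star_frame0 ?star_frame_lift; dotE; rewrite zt ?zb; lra.
have ze (f : line_graph K) : (- z) *d edge_sum c f = -1.
  have [x [y [_ nxy /(edge_sumE c nxy) ->]]] := edgeP f.
  by dotE; rewrite !zc; lra.
pose v (h : disjoint_union (line_graph K) (complete 1)) :=
  match h with inl f => edge_sum c f | inr _ => - z end.
have edge_gram := edge_sum_gram cc (rho := fun=> 1 / 2%:R).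
apply: (switching_of_gram (v := v)).
- case=> [f|u] [g|w] /=.
  + by rewrite edge_gram // => *; lra.
  + by rewrite dotC // ze.
  + by rewrite ze.
  + rewrite (ord1 u) (ord1 w) dotNl dotNr opprK /gram eqxx; exact: (line_norm LS).
- case=> [f|u] /=; last exact: (line_opp LS).
  have [x [y [_ nxy /(edge_sumE c nxy) ->]]] := edgeP f; exact: star_frame_line.
- move=> i.
  have edge : (exists k, parallel M (e i) (b k)) \/
     (exists k l, k != l /\ parallel M (e i) (t - b k - b l)) ->
     exists h, parallel M (e i) (v h).
    move=> /star_frame_cover[x [y [xy exy]]].
    by have [f fE] := edge_sum_onto c xy; exists (inl f); rewrite /v fE.
  have [eb|eY|ez] := cover _ (graph_line_basis R i).
  + by apply: edge; left.
  + by apply: edge; right.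
  + by exists (inr ord0); exact: parallel_opp.
Qed.

Lemma windmill_switching q (b : 'I_q -> 'rV[R]_#|G|) E : clique M X b ->
  E *d E = 4%:R -> (forall i, E *d b i = 2%:R) -> (forall i, X (E - b i)) ->
  (forall u, X u -> (exists i, parallel M u (b i)) \/
                    (exists i, parallel M u (E - b i))) ->
  switching_equivalent G (line_graph (complete_bipartite 2 q)).
Proof.
move=> cb EE Eb XE cover.
have e0 i : windmill_frame b E (inl ord0) + windmill_frame b E (inr i) = b i.
  by rewrite /= addrC subrK.
pose j1 : 'I_2 := lift ord0 ord0.
have e1 i : windmill_frame b E (inl j1) + windmill_frame b E (inr i) = - (E - b i).
  by apply/rowP => k; rewrite !mxE; lra.
apply: (@line_graph_switching (complete_bipartite 2 q) (windmill_frame b E)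
  (@left_side R q)).
- by move=> k l; apply: windmill_frame_dot => // i j; exact: (clique_dot LS).
- by case=> [s|i] [r|j] //= _; lra.
- have Xs s i : X (windmill_frame b E (inl s) + windmill_frame b E (inr i)).
    case: (unliftP ord0 s) => [s' ->|->]; last by rewrite e0; exact: cb.1.
    by rewrite (ord1 s') e1; apply: (line_opp LS).
  by case=> [s|i] [r|j] // _; rewrite addrC; exact: Xs.
- move=> i; have [[k ek]|[k ek]] := cover _ (graph_line_basis R i).
    by exists (inl ord0), (inr k); rewrite e0.
  by exists (inl j1), (inr k); rewrite e1; split=> //; exact: parallel_opp.
Qed.

Lemma order_sub_multiplicity :
  (#|G| - eigenvalue_multiplicity S 3%:R = \rank M)%N.
Proof.
rewrite /eigenvalue_multiplicity /eigenspace mxrank_ker -mxrank_opp opprB.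
by rewrite subKn // rank_leq_row.
Qed.

Lemma complete_star_rank q (b : 'I_q -> 'rV[R]_#|G|) t : q <> 7%N ->
  clique M X b -> star M X b t ->
  (forall i, (exists k, parallel M (e i) (b k)) \/
     (exists k l, k != l /\ parallel M (e i) (t - b k - b l)) \/
     parallel M (e i) (\sum_i b i - 2%:R *: t)) ->
  \rank M = q.+1.
Proof.
move=> q7 cb st cover; have [tt tb _] := st.
pose w := star_frame b t.
have ww k l : w k *d w l = 2%:R * (k == l)%:R - 1 / 2%:R * (1 / 2%:R).
  by apply: star_frame_dot => // i j; exact: (clique_dot LS).
have wb k : in_span M w (b k).
  by rewrite -(star_frame_edge0 b t); apply: in_spanD; exact: in_span_gen.
have wt : in_span M w t.
  have -> : t = 2%:R *: w ord0 by rewrite /w star_frame0 scalerA mulrC divfK ?scale1r // pnatr_eq0.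
  by apply: in_spanZ; exact: in_span_gen.
rewrite (rank_of_frame (w := w)) ?card_ord //.
- by apply: (complete_frame_free _ ww); rewrite card_ord => -[].
- move=> i; have [[k ek]|[[k [l [_ ekl]]]|ez]] := cover i.
  + exact: in_span_parallel ek _.
  + apply: in_span_parallel ekl _; do 2!(apply: in_spanD; last exact: in_spanN).
    exact: wt.
  + apply: in_span_parallel ez _; apply: in_spanD; first exact: in_span_sum.
    by apply: in_spanN; exact: in_spanZ.
Qed.

Lemma clique_rank q (b : 'I_q -> 'rV[R]_#|G|) :
  clique M X b -> (forall i, in_span M b (e i)) -> \rank M = q.
Proof.
move=> cb eb; rewrite (rank_of_frame (w := b)) ?card_ord //.
by apply: clique_free => i j; exact: (clique_dot LS).
Qed.

Lemma windmill_rank q (b : 'I_q -> 'rV[R]_#|G|) E : clique M X b ->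
  E *d E = 4%:R -> (forall i, E *d b i = 2%:R) ->
  (forall i, (exists k, parallel M (e i) (b k)) \/
             (exists k, parallel M (e i) (E - b k))) ->
  \rank M = q.+1.
Proof.
move=> cb EE Eb cover.
pose w (o : option 'I_q) := if o is Some i then b i - (1 / 2%:R) *: E else E.
have wE : in_span M w E by exact: (in_span_gen M w None).
have wb k : in_span M w (b k).
  have -> : b k = w (Some k) + (1 / 2%:R) *: E by rewrite /= subrK.
  by apply: in_spanD; [exact: in_span_gen | exact: in_spanZ].
rewrite (rank_of_frame (w := w)) ?card_option ?card_ord //.
- apply: orthogonal_frame_free => [[k|]|[k|] [l|]] //=.
  + dotE; rewrite EE (dotC symM (b k) E) Eb (clique_dot LS _ _ cb) eqxx.
    by apply/eqP => /=; lra.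
  + by rewrite EE pnatr_eq0.
  + move=> kl; dotE; rewrite EE (dotC symM (b k) E) !Eb (clique_dot LS _ _ cb).
    by rewrite -[k == l]/(Some k == Some l) (negbTE kl) /=; lra.
  + by move=> _; dotE; rewrite EE (dotC symM (b k) E) Eb; lra.
  + by move=> _; dotE; rewrite EE Eb; lra.
- move=> i; have [[k ek]|[k ek]] := cover i; apply: in_span_parallel ek _ => //.
  by apply: in_spanD => //; exact: in_spanN.
Qed.

(** The Gram matrix of a clique is nonsingular, whereas [M] is singular because [3] is
    an eigenvalue. *)
Lemma not_parallel_to_clique q (b : 'I_q -> 'rV[R]_#|G|) : clique M X b ->
  ~ forall u, X u -> exists i, parallel M u (b i).
Proof.
move=> cb cover.
have rk : \rank M = q.
  apply: (clique_rank cb) => i; have [k ek] := cover _ (graph_line_basis R i).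
  by apply: in_span_parallel ek _; exact: in_span_gen.
have [f fP] := @fin_all_exists 'I_#|G| (fun=> 'I_q)
  (fun i k => parallel M (e i) (b k)) (fun i => cover _ (graph_line_basis R i)).
have finj : injective f.
  move=> i j fij; apply/eqP; apply: contraT => ij.
  have := parallel_dot (e j) (fP i); have := parallel_dot (b (f i)) (fP j).
  rewrite fij !(dotC symM _ (e j)) (clique_dot LS _ _ cb) eqxx dot_basis /gram.
  by rewrite (inj_eq enum_val_inj) [j == i]eq_sym (negbTE ij); case: (adj _ _) => /=; lra.
have nq : (#|G| <= q)%N by have := leq_card f finj; rewrite !card_ord.
have /eigenvalueP[v vS v0] := largest3.1.
have : row_free M by rewrite /row_free eqn_leq rank_leq_row rk.
move/row_free_inj/(_ v 0); rewrite mul0mx mulmxBr vS mul_mx_scalar subrr.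
by move=> /(_ erefl) v00; rewrite v00 eqxx in v0.
Qed.

Lemma strongly_maximal_contra z : strongly_maximal_graph R G -> z *d z <= 3%:R ->
  (forall i, exists v, parallel M (e i) v /\ (z *d v = 1 \/ z *d v = -1)) -> False.
Proof.
move=> smax zz ze; apply: (strongly_maximal_no_extension largest3 smax zz) => i.
have [v [/parallel_dot-/(_ z) ev zv]] := ze i.
by rewrite !(dotC symM _ z) in ev; lra.
Qed.
End Switching.

(** * The classification of maximal graphs *)

Theorem theorem3p1 (R : rcfType) (G : sgraph) (n m : nat)
    (order_G : #|G| = n)
    (largest_G : largest_eigenvalue (seidel_mx R G) 3%:R)
    (mult_G : eigenvalue_multiplicity (seidel_mx R G) 3%:R = m)
    (max_G : maximal_graph R G) :
  [\/ (n - m = 5)%N /\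
        (switching_equivalent G (line_graph (complete 5)) \/
         switching_equivalent G (line_graph (complete_bipartite 2 4))),
      (n - m = 6)%N /\
        (switching_equivalent G
           (disjoint_union (line_graph (complete 6)) (complete 1)) \/
         switching_equivalent G (line_graph (complete_bipartite 2 5))),
      (n - m = 7)%N /\ switching_equivalent G (line_graph (complete 8))
    | [\/ (n - m = 3)%N, (n - m = 4)%N | (8 <= n - m)%N] /\
        switching_equivalent G
          (line_graph (complete_bipartite 2 (n - m - 1)%N))]
  /\ (strongly_maximal_graph R G ->
        switching_equivalent G (line_graph (complete 8))).
Proof.
have nm : (n - m)%N = \rank (3%:R%:M - seidel_mx R G).
  by rewrite -order_G -mult_G order_sub_multiplicity.
have symM := @seidel_gram_sym R G; have psdM := seidel_gram_psd largest_G.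
have LS := graph_line_system largest_G max_G.
have bound q b := @graph_clique_bound R G largest_G q b max_G.
have [q b cb cover|q b E cb q1 q6 EE Eb XE cover|q b t cb st q47 cover
  |b t cb st Xz cover] := classify_lines symM psdM LS bound.
- by case: (not_parallel_to_clique largest_G max_G cb cover).
- have sw := windmill_switching largest_G max_G cb EE Eb XE cover.
  have rk : \rank (3%:R%:M - seidel_mx R G) = q.+1.
    apply: (windmill_rank largest_G max_G cb EE Eb) => i.
    by apply: cover; exact: graph_line_basis.
  rewrite nm rk subn1 /=; split; last first.
    (* [E / 2] has norm 1 and product 1 with [b i] and with [E - b i] *)
    move=> smax; case: (@strongly_maximal_contra R G largest_G ((1 / 2%:R) *: E) smax).
      by dotE; rewrite EE; lra.
    move=> i; have [[k ek]|[k ek]] := cover _ (graph_line_basis R i).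
      by exists (b k); split=> //; left; dotE; rewrite Eb; lra.
    by exists (E - b k); split=> //; left; dotE; rewrite EE Eb; lra.
  have [q8|q7] := leqP 7 q; first by apply: Or44; split=> //; apply: Or33.
  have [q0|[q0|[q0|q0]]] : q = 2%N \/ q = 3%N \/ q = 4%N \/ q = 5%N by lia.
  + by rewrite q0 in sw *; apply: Or44; split=> //; exact: Or31.
  + by rewrite q0 in sw *; apply: Or44; split=> //; exact: Or32.
  + by rewrite q0 in sw *; apply: Or41; split=> //; right.
  + by rewrite q0 in sw *; apply: Or42; split=> //; right.
- have [tt tb _] := st.
  have sw := complete_star_switching largest_G max_G cb st cover.
  case: q47 => [q4|[q7 sum_t]].
    have rk : \rank (3%:R%:M - seidel_mx R G) = q.+1.
      apply: (complete_star_rank largest_G max_G _ cb st) => [|i]; first by rewrite q4.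
      by have [?|?] := cover _ (graph_line_basis R i); [left|right; left].
    rewrite nm rk q4; split; first by apply: Or41; split=> //; left; rewrite q4 in sw.
    (* [t - sum b / 3] has norm 5/3 and product 1 with [b k] and [t - b k - b l] *)
    move=> smax; have Sb k := sum_clique LS k cb.
    have St := star_sum_dot_center symM st; have SS := star_sum_norm symM LS cb.
    case: (@strongly_maximal_contra R G largest_G
             (t - (1 / 3%:R) *: \sum_i b i) smax).
      by dotE; rewrite (dotC symM t) St SS tt q4; lra.
    have zb k : dot (3%:R%:M - seidel_mx R G) (t - (1 / 3%:R) *: \sum_i b i) (b k) = 1.
      by dotE; rewrite tb Sb q4; lra.
    move=> i; have [[k ek]|[k [l [kl ekl]]]] := cover _ (graph_line_basis R i).
      by exists (b k); split=> //; left.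
    exists (t - b k - b l); split=> //; left; rewrite !dotDr !dotNr !zb.
    by dotE; rewrite tt St q4; lra.
  have rk : \rank (3%:R%:M - seidel_mx R G) = q.
    apply: (clique_rank largest_G max_G cb) => i.
    have gen := in_span_gen (3%:R%:M - seidel_mx R G) b.
    have bt : in_span (3%:R%:M - seidel_mx R G) b t.
      apply: (@in_span_same _ _ _ _ _ _ ((1 / 3%:R) *: \sum_i b i)).
        by move=> z; rewrite dotZl sum_t dotZl; field.
      by apply: in_spanZ; exact: in_span_sum.
    have [[k ek]|[k [l [_ ekl]]]] := cover _ (graph_line_basis R i).
      exact: in_span_parallel ek _.
    apply: in_span_parallel ekl _.
    by do 2!(apply: in_spanD; last exact: in_spanN).
  by rewrite nm rk q7; rewrite q7 in sw; split=> //; apply: Or43.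
have [tt tb _] := st.
have sw := complete_star_plus_switching largest_G max_G cb st Xz cover.
have rk : \rank (3%:R%:M - seidel_mx R G) = 6%N.
  apply: (complete_star_rank largest_G max_G _ cb st) => // i.
  by have [?|?|?] := cover _ (graph_line_basis R i);
    [left|right; left|right; right].
rewrite nm rk; split; first by apply: Or42; split=> //; left.
(* a vector of norm 2 with product 1 except for [sum b - 2 t], where it is -1 *)
move=> smax; have Sb k := sum_clique LS k cb.
have St := star_sum_dot_center symM st; have SS := star_sum_norm symM LS cb.
pose z := (3%:R / 2%:R) *: t - (1 / 2%:R) *: \sum_i b i.
have zb k : dot (3%:R%:M - seidel_mx R G) z (b k) = 1.
  by rewrite /z; dotE; rewrite tb Sb; lra.
have zt : dot (3%:R%:M - seidel_mx R G) z t = 3%:R.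
  by rewrite /z; dotE; rewrite tt St; lra.
have zS : dot (3%:R%:M - seidel_mx R G) z (\sum_i b i) = 5%:R.
  by rewrite dot_sumr // (@sum_const _ _ _ 1) //; lra.
case: (@strongly_maximal_contra R G largest_G z smax).
  by rewrite {2}/z !dotDr !dotNr !dotZr zt zS; lra.
clearbody z => i; have [[k ek]|[k [l [kl ekl]]]|ez] := cover _ (graph_line_basis R i).
- by exists (b k); split=> //; left.
- by exists (t - b k - b l); split=> //; left; dotE; rewrite zt !zb; lra.
- by exists (\sum_i b i - 2%:R *: t); split=> //; right; dotE; rewrite zt zS; lra.
Qed.
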